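(* Fix a positive integer $m$. For a prime $p$, let $N_2^m$ be the number of incomplete sequences $A$ of $\mathbb{Z}_p$ with $m(A)\le m$. Then, as $p\to\infty$, $$N_2^m=\exp\Big(\Big(\sqrt{\big(1-\tfrac{1}{m+1}\big)\tfrac{4}{3}}\,\pi+o(1)\Big)\sqrt{p}\Big).$$
   Context: $\mathbb{Z}_p$ is the cyclic group of prime order $p$. A sequence is a finite multiset of elements of $\mathbb{Z}_p$ (sequences are counted as multisets); $m(A)$ is its maximum multiplicity. $A$ is incomplete if the set of sums of non-empty subsequences (sub-multisets) of $A$ is not all of $\mathbb{Z}_p$. *)

(* Defs.v *)
From mathcomp Require Import all_boot all_order all_algebra finmap multiset.
From mathcomp Require Import all_classical all_reals all_analysis.

Set Implicit Arguments.
Unset Strict Implicit.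
Unset Printing Implicit Defensive.

Import Order.TTheory GRing.Theory Num.Theory.

Local Open Scope mset_scope.
Local Open Scope classical_set_scope.
Local Open Scope ring_scope.

(* A sequence of Z_p is a finite multiset [A : {mset 'F_p}]; [A x] is the
   multiplicity of [x] in [A].  All definitions are meant for prime [p]. *)

Definition max_mult (p : nat) (A : {mset 'F_p}) : nat :=
  (\max_(x : 'F_p) A x)%N.

Definition subseq_sums (p : nat) (A : {mset 'F_p}) : set 'F_p :=
  [set s | exists B : {mset 'F_p},
     [/\ (B `<=` A)%mset, B <> mset0 & s = \sum_(x <- B) x]].

Definition incomplete (p : nat) (A : {mset 'F_p}) : Prop :=
  subseq_sums A <> setT.

Definition incomplete_seqs (m p : nat) : set {mset 'F_p} :=
  [set A | incomplete A /\ (max_mult A <= m)%N].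

Arguments incomplete_seqs : clear implicits.

Lemma finite_incomplete_seqs (m p : nat) : finite_set (incomplete_seqs m p).
Proof.
pose f (g : {ffun 'F_p -> 'I_m.+1}) : {mset 'F_p} :=
  [fsfun x in [fset x | x : 'F_p]%fset => nat_of_ord (g x)].
apply: (@sub_finite_set _ _ (f @` setT)); last exact: finite_image.
move=> A [_ leAm]; exists [ffun x => inord (A x)] => //.
apply/msetP => x; rewrite /f fsfunE !inE /= ffunE inordK // ltnS.
exact: leq_trans (leq_bigmax x) leAm.
Qed.

(* [fset_set] is the empty set on infinite arguments, which is harmless by the
   previous lemma. *)
Definition N2 (m p : nat) : nat := #|` fset_set (incomplete_seqs m p)|%fset.

(* Main.v *)
(* Let [lam B x = #|(x + B) \ B|]; it is subadditive in [x], and its values sum to give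
   [sum_T #|{lam B <= T}| = #|B|^2] over [T < #|B|].  With Cauchy-Davenport this forces
   [#|{lam B <= t}| <= (2 + o(1)) t + 1] for [t] small compared to [#|B|], as if [lam B x]
   were the distance from [x] to 0 after a dilation.

   Upper bound.  Let [A] be incomplete with [n] terms.  Ordering [A] at random, the subset
   sums of the first [n / K] terms number about [p / K] on average (Cauchy-Davenport on
   consecutive blocks), and each further term [a] adds [lam B a] new sums, where [B] is the
   current set of sums.  Averaging, some short subsequence of [A] has a set of sums [B] such
   that the values [lam B a] over the other terms of [A] sum to at most [(1 + o(1)) p].  The
   short part can be chosen in [exp(o(sqrt p))] ways; given it, Rankin's trick and the level
   bound count the rest by a partition-type generating function with two parts of each
   size, whose logarithm at [exp (- s)] is asymptotic to [(pi^2 / 3) (1 - 1 / (m + 1)) / s].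

   Lower bound.  If the distances of the terms to the nearest multiple of [p] sum to at most
   [p - 2], the subset sums lie in an interval of length less than [p - 1]; exponential tilting
   of the same generating function counts these sequences. *)
From HB Require Import structures.
Require Import Defs.
From mathcomp Require Import all_boot all_order all_algebra all_fingroup.
From mathcomp Require Import ring lra zify.

Set Implicit Arguments.
Unset Strict Implicit.
Unset Printing Implicit Defensive.

Import GRing.Theory.
Local Open Scope ring_scope.

(** * Sumsets modulo a prime *)

Definition translate (V : finZmodType) (x : V) (B : {set V}) : {set V} :=
  [set x + b | b in B].

Definition sumset (V : finZmodType) (A B : {set V}) : {set V} :=
  [set a + b | a in A, b in B].

(* Olson's function: the number of sums gained when the term [x] is adjoined to a sequence
   whose set of subset sums is [B]. *)
Definition lam (V : finZmodType) (B : {set V}) (x : V) : nat :=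
  #|translate x B :\: B|.

Section Sumsets.
Variable V : finZmodType.
Implicit Types (A B C D : {set V}) (x y : V).

Lemma mem_translate x y B : (y \in translate x B) = (y - x \in B).
Proof.
apply/imsetP/idP => [[b bB ->]|yB]; first by rewrite addrC addKr.
by exists (y - x); rewrite // addrC subrK.
Qed.

Lemma card_translate x B : #|translate x B| = #|B|.
Proof. by apply: card_imset; apply: addrI. Qed.

Lemma mem_sumset a b A B : a \in A -> b \in B -> a + b \in sumset A B.
Proof. exact: imset2_f. Qed.

Lemma sumsetC : commutative (@sumset V).
Proof.
move=> A B; apply/setP => x.
by apply/imset2P/imset2P => -[a b aA bB ->]; exists b a; rewrite // addrC.
Qed.

Lemma sumsetA : associative (@sumset V).
Proof.
move=> A B C; apply/setP => x; apply/imset2P/imset2P.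
  move=> [a _ aA /imset2P[b c bB cC ->] ->].
  by exists (a + b) c; rewrite ?mem_sumset // addrA.
move=> [_ c /imset2P[a b aA bB ->] cC ->].
by exists a (b + c); rewrite ?mem_sumset // addrA.
Qed.

Lemma sum0set : left_id [set 0] (@sumset V).
Proof.
move=> A; apply/setP => x; apply/imset2P/idP => [[a b /set1P-> bA ->]|xA].
  by rewrite add0r.
by exists 0 x; rewrite ?inE ?add0r.
Qed.

HB.instance Definition _ :=
  Monoid.isComLaw.Build {set V} [set 0] (@sumset V) sumsetA sumsetC sum0set.

Lemma sumsetSS A B C D : A \subset C -> B \subset D -> sumset A B \subset sumset C D.
Proof.
move=> sAC sBD; apply/subsetP => _ /imset2P[a b aA bB ->].
by rewrite mem_sumset ?(subsetP sAC) ?(subsetP sBD).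
Qed.

Lemma lam0 B : lam B 0 = 0%N.
Proof.
apply/eqP; rewrite cards_eq0 setD_eq0; apply/subsetP => y.
by rewrite mem_translate subr0.
Qed.

Lemma lamE B x : lam B x = (#|B| - #|translate x B :&: B|)%N.
Proof. by rewrite -(card_translate x B) -(cardsID B (translate x B)) addKn. Qed.

Lemma lam_leq B x : (lam B x <= #|B|)%N.
Proof. by rewrite lamE leq_subr. Qed.

(** Pass from [B] to its translate by [x + y] through the translate by [x]: a new point either lies
    outside the translate by [x], which happens [lam B y] times, or lies in it and not in [B]. *)
Lemma lamD B x y : (lam B (x + y)%R <= lam B x + lam B y)%N.
Proof.
have -> : lam B y = #|translate (x + y) B :\: translate x B|.
  rewrite /lam -(card_translate x); apply: eq_card => z.
  by rewrite !(inE, mem_translate) opprD addrA.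
rewrite addnC /lam -cardsUI.
apply: leq_trans (leq_addr _ _); apply: subset_leq_card; apply/subsetP => z.
by rewrite !inE => /andP[/negbTE-> ->]; case: (_ \in _).
Qed.

Lemma card_sumset_pair B x : #|sumset B [set 0; x]| = (#|B| + lam B x)%N.
Proof.
have -> : sumset B [set 0; x] = B :|: translate x B.
  apply/setP => z; rewrite inE mem_translate; apply/imset2P/idP.
    by move=> [b y bB /set2P[]-> ->]; rewrite ?addr0 ?addrK bB ?orbT.
  case/orP => zB; first by exists z 0; rewrite ?inE ?eqxx ?addr0.
  by exists (z - x) x; rewrite ?inE ?eqxx ?orbT ?subrK.
by rewrite -(cardsID B) setUK setDUl setDv set0U.
Qed.

(* Double counting: the translates of [B] meet [B] in [#|B|^2] points in all. *)
Lemma sum_compl_lam B : (\sum_x (#|B| - lam B x) = #|B| ^ 2)%N.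
Proof.
have E x : (#|B| - lam B x = \sum_(y in B) ((y - x)%R \in B))%N.
  rewrite lamE subKn ?subset_leq_card ?subsetIr // -sum1_card.
  rewrite big_mkcond [RHS]big_mkcond; apply: eq_bigr => y _.
  by rewrite inE mem_translate; case: (y \in B); case: (_ \in B).
under eq_bigr do rewrite E.
rewrite exchange_big /= (eq_bigr (fun=> #|B|)) ?sum_nat_const ?mulnn // => y _.
rewrite (reindex_inj (h := fun x => y - x)) /=; last by move=> u v /addrI/oppr_inj.
under eq_bigr do rewrite subKr.
by rewrite -sum1_card [RHS]big_mkcond; apply: eq_bigr => x _; case: (_ \in _).
Qed.

(** Each [x] lies in exactly [#|B| - lam B x] of the levels; exchange the two sums. *)
Lemma sum_card_lam_leq B :
  (\sum_(T < #|B|) #|[set x | lam B x <= T]| = #|B| ^ 2)%N.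
Proof.
rewrite -sum_compl_lam (eq_bigr (fun T : 'I_#|B| => \sum_x (lam B x <= T))%N); last first.
  move=> T _; rewrite -sum1_card big_mkcond; apply: eq_bigr => x _.
  by rewrite inE; case: leqP.
rewrite exchange_big; apply: eq_bigr => x _ /=.
rewrite -(big_mkord xpredT (fun T => nat_of_bool (lam B x <= T)%N)).
rewrite (big_cat_nat _ (lam_leq B x)) //= big_nat big1 ?add0n => [|T /andP[_]]; last first.
  by rewrite ltnNge => /negbTE->.
rewrite big_nat (eq_bigr (fun=> 1%N)) => [|T /andP[-> _]] //.
by rewrite -big_nat sum_nat_const_nat muln1.
Qed.

Lemma lam_leqD B s t :
  sumset [set x | lam B x <= s]%N [set x | lam B x <= t]%N
    \subset [set x | lam B x <= s + t]%N.
Proof.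
apply/subsetP => _ /imset2P[x y xs yt ->]; rewrite !inE in xs yt *.
exact: leq_trans (lamD B x y) (leq_add xs yt).
Qed.

End Sumsets.

(** * Cauchy-Davenport and the level sets of [lam] *)

Section PrimeOrder.
Variables (p : nat) (p_pr : prime p).
Implicit Types (A B : {set 'F_p}).

(** A nonzero [d] generates the group: [x] is reached from [a] in [(x - a) / d] steps, this residue
    being read as a natural number. *)
Lemma add_stable_setT A d : A != set0 -> d != 0 ->
  (forall x, x \in A -> x + d \in A) -> A = setT.
Proof.
case/set0Pn=> a aA d0 stab; apply/setP => x; rewrite inE.
have {stab} H k : a + d *+ k \in A.
  by elim: k => [|k IH]; rewrite ?mulr0n ?addr0 // mulrSr addrA stab.
have -> : x = a + d *+ ((x - a) / d); last by rewrite H.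
by rewrite -[d *+ _]mulr_natr natr_Zp mulrCA divff // mulr1 addrC subrK.
Qed.

(* Induction on [#|B|] by the e-transform [(A, B) -> (A :|: (B + e), B :&: (A - e))]. *)
Lemma cauchy_davenport A B : A != set0 -> B != set0 ->
  (minn p (#|A| + #|B|).-1 <= #|sumset A B|)%N.
Proof.
have [n] := ubnP #|B|; elim: n A B => // n IHn A B ltBn A0 B0.
have [/existsP[e /andP[I0 pI]]|] := boolP [exists e,
    (B :&: translate (- e) A != set0) && (B :&: translate (- e) A \proper B)].
  set B' := B :&: _ in I0 pI; pose A' := A :|: translate e B.
  have AA' : A \subset A' := subsetUl _ _.
  have A'0 : A' != set0 by apply: contraNneq A0 => A'0; rewrite -subset0 -A'0.
  have ltB' : (#|B'| < n)%N by apply: leq_trans (proper_card pI) _.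
  have cE : (#|A'| + #|B'| = #|A| + #|B|)%N.
    rewrite -(card_translate e B') -(card_translate e B) -[RHS]cardsUI; congr (_ + _)%N.
    by apply: eq_card => x; rewrite !(inE, mem_translate) opprK subrK andbC.
  rewrite -cE; apply: leq_trans (IHn A' B' ltB' A'0 I0) (subset_leq_card _).
  apply/subsetP => _ /imset2P[x y xA' yB' ->]; move: xA' yB'.
  rewrite !(inE, mem_translate) opprK => /orP[xA|xB] /andP[yB yA]; first by rewrite mem_sumset.
  by rewrite -(subrK e x) -addrA [e + y]addrC addrC mem_sumset.
rewrite negb_exists => /forallP H.
have [B1|/card_gt1P[b [b' [bB b'B neb]]]] := leqP #|B| 1.
  have {B1} B1 : #|B| = 1%N by apply/eqP; rewrite eqn_leq B1 card_gt0.
  have [b bB] := set0Pn _ B0.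
  rewrite B1 addn1 /= -(card_translate b A) geq_min; apply/orP; right.
  apply: subset_leq_card; apply/subsetP => x; rewrite mem_translate => xA.
  by rewrite -(subrK b x) mem_sumset.
(* With [e = x - b] the point [b] lies in [B :&: translate (- e) A]; as this intersection is never
   both nonempty and proper, it is all of [B] and contains [b']. *)
have stab x : x \in A -> x + (b' - b) \in A.
  move=> xA; have := H (x - b); rewrite negb_and negbK => /orP[/eqP/setP/(_ b)|].
    by rewrite !(inE, mem_translate) bB opprK addrC subrK xA.
  rewrite properE subsetIl negbK subsetI subxx => /subsetP/(_ _ b'B).
  by rewrite mem_translate opprK addrCA.
have AT := add_stable_setT A0 _ stab.
have [y yB] := set0Pn _ B0.
rewrite AT ?subr_eq0 1?eq_sym // cardsT card_Fp // geq_min; apply/orP; left.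
rewrite -[X in (X <= _)%N](card_Fp p_pr) -cardsT; apply: subset_leq_card.
by apply/subsetP => x _; rewrite -(subrK y x) mem_sumset.
Qed.

(** By subadditivity the [j]-fold sumset of the level [t] lies in the level [j * t], and each
    summand gains at least [c] elements until [p] is reached. *)
Lemma card_lam_leq_iter B t j c : (c < #|[set x | lam B x <= t]|)%N ->
  (minn p (j * c).+1 <= #|[set x | lam B x <= j * t]|)%N.
Proof.
move=> ltc; elim: j => [|j IHj].
  rewrite mul0n geq_min; apply/orP; right.
  by apply/card_gt0P; exists 0; rewrite inE lam0.
have L0 k : [set x | lam B x <= k]%N != set0 by apply/set0Pn; exists 0; rewrite inE lam0.
have := subset_leq_card (lam_leqD B (j * t) t); rewrite -mulSnr => le1.
have := cauchy_davenport (L0 (j * t)%N) (L0 t); move: le1 IHj ltc.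
rewrite [in (j.+1 * c)%N]mulSn; move: (j * c)%N #|_| #|_| #|_| #|_| => u a1 a2 a3 a4.
by lia.
Qed.

Lemma lam_gt0 B x : B != set0 -> B != setT -> x != 0 -> (0 < lam B x)%N.
Proof.
move=> B0 BT x0; rewrite lt0n; apply: contra BT; rewrite cards_eq0 setD_eq0 => /subsetP sB.
apply/eqP/(add_stable_setT B0 x0) => y yB; apply: sB.
by rewrite mem_translate addrK.
Qed.

(* The levels [L_T] of [lam B] have total size [#|B|^2], while
   [#|L_T| >= (T %/ t) * c + 1] as soon as [#|L_t| > c]. *)
Lemma card_lam_leq B t c : (0 < t)%N -> (4 * t <= #|B|)%N -> (5 * #|B| <= p)%N ->
  (c < #|[set x | lam B x <= t]|)%N -> (c * (#|B|.+1 - 2 * t) <= 2 * t * #|B|)%N.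
Proof.
set b := #|B| => t0 tb bp ltc; rewrite leqNgt; apply/negP => cbig.
(* Take for [c] the least value violating the bound. The bound at [c.-1] gives [c <= 5 * t], which
   keeps [T %/ t * c] below [p], so that [card_lam_leq_iter] is not capped by [p]. *)
wlog cmin : c ltc cbig / (c.-1 * (b.+1 - 2 * t) <= 2 * t * b)%N.
  move=> W; elim: c ltc cbig => [|c IHc] ltc cbig; first by rewrite mul0n in cbig.
  have [h|h] := leqP (c * (b.+1 - 2 * t)) (2 * t * b); first exact: W ltc cbig h.
  by apply: IHc => //; apply: ltnW.
have c5 : (c <= 5 * t)%N by nia.
have jle T : (T < b)%N -> (T %/ t * c < #|[set x | lam B x <= T]|)%N.
  move=> Tb; have h1 := card_lam_leq_iter (T %/ t) ltc.
  have h2 : (#|[set x | lam B x <= T %/ t * t]| <= #|[set x | lam B x <= T]|)%N.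
    apply: subset_leq_card; apply/subsetP => x; rewrite !inE => h.
    by apply: leq_trans h (leq_trunc_div _ _).
  have h3 : (T %/ t * c < p)%N.
    have := leq_trunc_div T t; nia.
  by lia.
have S1 : (\sum_(T < b) (T %/ t * c).+1 <= b ^ 2)%N.
  by rewrite -(sum_card_lam_leq B); apply: leq_sum => T _; apply: jle.
(* This is [t * (T %/ t) >= T + 1 - t] multiplied by [2 * c] and summed over [T < k]. *)
have S2 k : (c * k * k + c * k <= 2 * c * k * t + 2 * t * \sum_(T < k) (T %/ t * c))%N.
  elim: k => [|k IHk]; first by rewrite big_ord0; lia.
  have h : (c * k.+1 <= c * (t + k %/ t * t))%N.
    by rewrite leq_mul2l; apply/orP; right; have := divn_eq k t; have := ltn_pmod k t0; lia.
  rewrite big_ord_recr /=.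
  by move: (k %/ t)%N (\sum_(_ < _) _)%N IHk h => q s; lia.
have S3 : (\sum_(T < b) (T %/ t * c).+1 = \sum_(T < b) (T %/ t * c) + b)%N.
  under eq_bigr do rewrite -addn1.
  by rewrite big_split /= sum_nat_const card_ord muln1.
have := S2 b; move: S1; rewrite S3.
move: (\sum_(_ < _) _)%N => s h1 h2; have h3 := leq_mul (leqnn (2 * t)) h1.
have h4 : (b * (2 * t * b) < b * (c * (b.+1 - 2 * t)))%N by rewrite ltn_mul2l cbig; lia.
have h5 : (b.+1 - 2 * t + 2 * t = b.+1)%N by lia.
have h6 : (b * c * (b.+1 - 2 * t) + b * c * (2 * t) = b * c * b.+1)%N by rewrite -mulnDr h5.
by lia.
Qed.

End PrimeOrder.

(** A cruder bound for the phase where the sums are still growing. If [0 < t], then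
    [#|B|.+1 - 2 * t] exceeds half of [#|B|] and [card_lam_leq] rules out [c = 4 * t + 1]; for
    [t = 0], only [0] brings no gain. *)
Lemma card_lam_leq_linear (p : nat) (B : {set 'F_p}) (t : nat) : prime p ->
  (4 * t <= #|B|)%N -> (5 * #|B| <= p)%N -> B != set0 ->
  (#|[set x | lam B x <= t]| <= (4 * t).+1)%N.
Proof.
move=> p_pr tb bp B0; have [t0|t0] := posnP t.
  rewrite t0 muln0 -(cards1 (0 : 'F_p)); apply: subset_leq_card.
  apply/subsetP => x; rewrite !inE leqn0 => lx0; apply: contraLR lx0 => x0.
  rewrite -lt0n; apply: lam_gt0 => //.
  apply: contraTneq bp => ->; rewrite cardsT card_Fp //.
  by have := prime_gt0 p_pr; lia.
rewrite leqNgt; apply/negP => h.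
by have := card_lam_leq p_pr t0 tb bp h; nia.
Qed.

(** * Growth of the set of subset sums *)

(** The empty sum is allowed here, unlike in [subseq_sums], so [0] always belongs; adjoining a term
    is one product in the sumset monoid. *)
Definition subset_sums (V : finZmodType) (T : finType) (a : T -> V) (I : {set T}) : {set V} :=
  \big[@sumset V/[set 0]]_(j in I) [set 0; a j].

Section SubsetSums.
Variables (V : finZmodType) (T : finType) (a : T -> V).
Implicit Types (I J : {set T}).
Local Notation S := (subset_sums a).

Lemma subset_sumsU I J : [disjoint I & J] -> S (I :|: J) = sumset (S I) (S J).
Proof.
by move=> dIJ; rewrite /subset_sums -bigU //; apply: eq_bigl => j; rewrite inE.
Qed.

Lemma subset_sums_has0 I : 0 \in S I.
Proof.
apply: (big_ind (fun A : {set V} => 0 \in A)); rewrite ?inE ?eqxx //.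
  by move=> A B A0 B0; rewrite -[0]addr0 mem_sumset.
by move=> j _; rewrite !inE eqxx.
Qed.

Lemma subset_sums_neq0 I : S I != set0.
Proof. by apply/set0Pn; exists 0; apply: subset_sums_has0. Qed.

Lemma subset_sumsS I J : I \subset J -> S I \subset S J.
Proof.
move=> sIJ; have -> : S J = sumset (S (J :\: I)) (S I).
  by rewrite sumsetC {1}/subset_sums (big_setID I) /= (setIidPr sIJ).
by rewrite -{1}[S I]sum0set sumsetSS ?subxx // sub1set subset_sums_has0.
Qed.

Lemma card_subset_sums_setU1 I j : j \notin I ->
  #|S (j |: I)| = (#|S I| + lam (S I) (a j))%N.
Proof.
by move=> jI; rewrite /subset_sums big_setU1 //= sumsetC card_sumset_pair.
Qed.

End SubsetSums.

Section Growth.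
Variables (p : nat) (p_pr : prime p) (T : finType) (a : T -> 'F_p) (m : nat).
Implicit Types (I J : {set T}).
Local Notation S := (subset_sums a).

Lemma growth_step I J u c : J \subset I ->
  (forall x, #|[set j in I | a j == x]| <= m)%N -> (m * c < #|I :\: J|)%N ->
  (#|[set x | lam (S J) x <= u]| <= c)%N ->
  exists2 j, j \in I :\: J & (#|S J| + u < #|S (j |: J)|)%N.
Proof.
move=> sJI fib lt_mc leLc.
have [/exists_inP[j jIJ ltu]|] := boolP [exists j in I :\: J, (u < lam (S J) (a j))%N].
  exists j => //; rewrite card_subset_sums_setU1 ?ltn_add2l //.
  by case/setDP: jIJ.
rewrite negb_exists_in => /forall_inP lam_le; suff: (#|I :\: J| <= m * c)%N by rewrite leqNgt lt_mc.
rewrite mulnC; apply: leq_trans (leq_mul leLc (leqnn m)); rewrite -sum_nat_const.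
have -> : #|I :\: J| = (\sum_(x in [set x | lam (S J) x <= u]%N)
    #|[set j in I :\: J | a j == x]|)%N.
  rewrite -sum1_card (partition_big a (mem [set x | lam (S J) x <= u]%N)) /=; last first.
    by move=> j /lam_le; rewrite -leqNgt inE.
  by apply: eq_bigr => x _; rewrite -sum1_card; apply: eq_bigl => j; rewrite !inE.
apply: leq_sum => x _; apply: leq_trans (fib x); apply: subset_leq_card.
by apply/subsetP => j; rewrite !inE => /andP[/andP[_ ->] ->].
Qed.

(** The level hypothesis is asked of every large enough [B] because the set of sums changes at each
    step. Once that set exceeds [p / 5] the hypothesis is lost, and arbitrary terms are added to
    reach the required number. *)
Lemma growth_iter I J u c k : J \subset I ->
  (forall x, #|[set j in I | a j == x]| <= m)%N -> (m * c + k <= #|I :\: J|)%N ->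
  (forall B : {set 'F_p}, B != set0 -> #|S J| <= #|B| -> 5 * #|B| <= p ->
     #|[set x | lam B x <= u]| <= c)%N ->
  exists J', [/\ J' \subset I, J \subset J', #|J'| = (#|J| + k)%N &
    (#|S J| + k * u.+1 <= #|S J'|)%N \/ (p < 5 * #|S J'|)%N].
Proof.
move=> sJI fib + small; elim: k => [|k IHk] le_mc.
  by exists J; split; rewrite ?addn0 //; left.
have [|J' [sJ'I sJJ' cJ' gr]] := IHk; first by lia.
have cIJ' : #|I :\: J'| = (#|I :\: J| - k)%N.
  by rewrite !cardsDS // cJ'; lia.
have sS := subset_leq_card (subset_sumsS a sJJ').
have [|le5] := ltnP p (5 * #|S J'|).
  have /card_gt0P[j jIJ'] : (0 < #|I :\: J'|)%N by rewrite cIJ'; lia.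
  move/setDP: (jIJ') => [jI jJ'] lt5; exists (j |: J'); split.
  - by rewrite subUset sub1set jI.
  - by apply: subset_trans sJJ' (subsetUr _ _).
  - by rewrite cardsU1 jJ' cJ'; lia.
  - right; apply: leq_trans lt5 _.
    by rewrite leq_mul2l subset_leq_card // subset_sumsS // subsetUr.
have [|j jIJ' ltu] := growth_step sJ'I fib _ (small _ (subset_sums_neq0 a J') sS le5).
  by rewrite cIJ'; lia.
move/setDP: (jIJ') => [jI jJ']; exists (j |: J'); split.
- by rewrite subUset sub1set jI.
- by apply: subset_trans sJJ' (subsetUr _ _).
- by rewrite cardsU1 jJ' cJ'; lia.
- case: gr => gr; last by lia.
  by left; rewrite mulSn; lia.
Qed.

(** Two phases. First [4 * t] terms gain at least 1 each, since only [0] gains nothing; then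
    [card_lam_leq_linear] applies at level [t], and [t] further terms gain more than [t] each. *)
Lemma card_subset_sums_quadratic I t :
  (forall x, #|[set j in I | a j == x]| <= m)%N -> (m * (4 * t).+1 + 5 * t <= #|I|)%N ->
  (t ^ 2 <= #|S I|)%N \/ (p < 5 * #|S I|)%N.
Proof.
move=> fib leI.
have S0 : S set0 = [set 0] by rewrite /subset_sums big_set0.
have [||J [sJI _ cJ gr]] := @growth_iter I set0 0 1 (4 * t) (sub0set I) fib.
- by rewrite setD0; lia.
- by move=> B B0 _ le5; apply: (@card_lam_leq_linear p B 0).
have sS := subset_leq_card (subset_sumsS a sJI).
case: gr => gr; last by right; lia.
rewrite S0 cards1 in gr.
have [||J' [sJ'I sJJ' cJ' gr']] := @growth_iter I J t (4 * t).+1 t sJI fib.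
- by rewrite cardsDS // cJ cards0; lia.
- by move=> B B0 leB le5; apply: card_lam_leq_linear => //; lia.
have sS' := subset_leq_card (subset_sumsS a sJ'I).
by case: gr' => gr'; [left | right]; lia.
Qed.

End Growth.

(** * Averaging over orderings *)

Section Averaging.
Variables (p : nat) (p_pr : prime p) (n : nat) (a : 'I_n -> 'F_p).
Hypothesis ST : subset_sums a setT != setT.
Local Notation S := (subset_sums a).
Local Notation P i := [set j : 'I_n | (j < i)%N].

(** The sums of the whole sequence miss a residue, so the minimum in Cauchy-Davenport is never [p];
    thus [#|S I| - 1] is superadditive. *)
Lemma card_subset_sumsU (I J : {set 'I_n}) : [disjoint I & J] ->
  (#|S I| + #|S J| <= #|S (I :|: J)|.+1)%N.
Proof.
move=> dIJ; have := cauchy_davenport p_pr (subset_sums_neq0 a I) (subset_sums_neq0 a J).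
rewrite -subset_sumsU //; have ltp : (#|S (I :|: J)| < p)%N.
  rewrite -[X in (_ < X)%N](card_Fp p_pr) -cardsT proper_card //.
  by apply: sub_proper_trans (subset_sumsS a (subsetT _)) _; rewrite properT.
by rewrite geq_min leqNgt ltp /= -subn1 leq_subLR add1n.
Qed.

Lemma card_subset_sums_blocks (s : 'S_n) (H k : nat) :
  (\sum_(i < k) #|S (s @: (P (i.+1 * H) :\: P (i * H)))|.-1 < #|S (s @: (P (k * H)))|)%N.
Proof.
elim: k => [|k IHk]; first by rewrite big_ord0 card_gt0 subset_sums_neq0.
rewrite big_ord_recr /=; set D := P (k.+1 * H) :\: P (k * H).
have E : s @: P (k.+1 * H) = s @: P (k * H) :|: s @: D.
  suff -> : P (k.+1 * H) = P (k * H) :|: D by rewrite imsetU.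
  by apply/setP => j; rewrite !inE; lia.
have dis : [disjoint s @: P (k * H) & s @: D].
  rewrite imset_disjoint; last exact: perm_inj.
  by rewrite -setI_eq0 setIDA setIC; apply/eqP/setP => j; rewrite !inE; lia.
have := card_subset_sumsU dis; rewrite -E.
have : (0 < #|S (s @: D)|)%N by rewrite card_gt0 subset_sums_neq0.
move: IHk; move: #|_| #|_| #|_| (\sum_(_ < _) _)%N => x y z t; lia.
Qed.

Lemma sum_perm_imset (F : {set 'I_n} -> nat) (t : 'S_n) (I : {set 'I_n}) :
  (\sum_(s : 'S_n) F (s @: (t @: I)) = \sum_(s : 'S_n) F (s @: I))%N.
Proof.
rewrite [RHS](reindex_inj (mulgI t)) /=; apply: eq_bigr => s _; congr (F _).
by rewrite -imset_comp; apply: eq_imset => j /=; rewrite permM.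
Qed.

(** Translation modulo [n] carries the first block of length [H] to any other, so averages over all
    orderings are the same for every block. *)
Lemma shift_block (H k : nat) : (k.+1 * H <= n)%N -> exists t : 'S_n,
  P (k.+1 * H) :\: P (k * H) = t @: P H.
Proof.
case: n => [|n'] leH.
  by exists 1%g; apply/setP => -[].
pose c : 'I_n'.+1 := inord (k * H).
have [H0|H0] := posnP H.
  exists 1%g; apply/setP => j; rewrite H0 !muln0 !inE ltn0 andbF.
  by apply/esym/imsetP => -[i]; rewrite inE.
have cE : c = (k * H)%N :> nat by rewrite inordK //; lia.
exists (perm (@addrI _ c)); apply/setP => j; rewrite !inE; apply/idP/imsetP.
  move=> /andP[lej ltj]; have ltjn := ltn_ord j.
  have jE : (inord (j - k * H) : 'I_n'.+1) = (j - k * H)%N :> nat by rewrite inordK //; lia.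
  exists (inord (j - k * H)); first by rewrite inE jE; lia.
  by rewrite permE; apply: val_inj; rewrite /= jE cE modn_small; lia.
move=> [i]; rewrite inE permE => ltiH -> /=.
by rewrite cE modn_small; lia.
Qed.

(** In each ordering the values [#|S| - 1] of [q] disjoint blocks add up to at most [p - 1], and on
    average all blocks share equally. *)
Lemma sum_perm_card_prefix (H q : nat) : (q * H <= n)%N ->
  (q * \sum_(s : 'S_n) #|S (s @: P H)|.-1 <= n`! * p.-1)%N.
Proof.
move=> qH; have -> : (q * \sum_(s : 'S_n) #|S (s @: P H)|.-1 =
    \sum_(s : 'S_n) \sum_(i < q) #|S (s @: (P (i.+1 * H) :\: P (i * H)))|.-1)%N.
  rewrite exchange_big /= -[q in LHS]card_ord -sum_nat_const; apply: eq_bigr => i _.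
  have [|t ->] := @shift_block H i; last by rewrite (sum_perm_imset (fun I => #|S I|.-1)).
  by have := ltn_ord i; nia.
have -> : n`! = #|{: 'S_n}| by rewrite card_Sn.
rewrite -sum_nat_const; apply: leq_sum => s _.
have := card_subset_sums_blocks s H q; have : (#|S (s @: P (q * H))| <= p)%N.
  by rewrite -[X in (_ <= X)%N](card_Fp p_pr) -cardsT subset_leq_card ?subsetT.
have := prime_gt0 p_pr.
by move: #|_| (\sum_(_ < _) _)%N => x y; lia.
Qed.

Definition remaining_growth (s : 'S_n) (i : nat) : nat :=
  (\sum_(j : 'I_n | i <= j) lam (S (s @: P i)) (a (s j)))%N.

(** Swapping positions [i] and [j] keeps the first [i] terms in place, so each of the [n - i]
    remaining terms gains on average as much as the one at position [i]. *)
Lemma sum_perm_remaining (i : 'I_n) :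
  (\sum_(s : 'S_n) remaining_growth s i =
   (n - i) * \sum_(s : 'S_n) lam (S (s @: P i)) (a (s i)))%N.
Proof.
rewrite exchange_big /= (eq_bigr (fun=> \sum_(s : 'S_n) lam (S (s @: P i)) (a (s i)))%N).
  rewrite sum_nat_const; congr (_ * _)%N.
  rewrite -sum1_card -(big_mkord (fun j => i <= j)%N (fun=> 1%N)).
  rewrite (big_cat_nat _ (ltnW (ltn_ord i))) //=.
  rewrite big_nat_cond big1 ?add0n => [|j /andP[/andP[_]]]; last first.
    by rewrite ltnNge => /negP.
  rewrite big_nat_cond (eq_bigl (fun j => (i <= j < n)%N && true)).
    by rewrite -big_nat_cond sum_nat_const_nat muln1.
  by move=> j; rewrite andbT andb_idr // => /andP[].
move=> j leij; rewrite [RHS](reindex_inj (mulgI (tperm i j))) /=; apply: eq_bigr => s _.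
rewrite permM tpermL; congr (lam (S _) _); apply/setP => x.
apply/imsetP/imsetP => -[k]; rewrite inE => ltki -> ; exists k; rewrite ?inE ?permM ?tpermD //;
  by apply: contraTneq ltki => <-; rewrite -leqNgt.
Qed.

(** The average gain of the term at position [i] is the increment of the average of [#|S|];
    [n - i <= n] times it is the average remaining growth, and the increments telescope. *)
Lemma sum_perm_increments (h H : nat) : (h <= H)%N -> (H <= n)%N ->
  (\sum_(h <= i < H) \sum_(s : 'S_n) remaining_growth s i <=
   n * \sum_(s : 'S_n) #|S (s @: P H)|.-1)%N.
Proof.
move=> hH Hn.
have step (s : 'S_n) (i : 'I_n) :
    #|S (s @: P i.+1)| = (#|S (s @: P i)| + lam (S (s @: P i)) (a (s i)))%N.
  have -> : P i.+1 = i |: P i.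
    by apply/setP => j; rewrite !inE ltnS leq_eqVlt.
  rewrite imsetU1 card_subset_sums_setU1 //; apply/imsetP => -[j].
  by rewrite inE => ltji /perm_inj eij; rewrite eij ltnn in ltji.
suff : (\sum_(h <= i < H) \sum_(s : 'S_n) remaining_growth s i +
    n * \sum_(s : 'S_n) #|S (s @: P h)|.-1 <= n * \sum_(s : 'S_n) #|S (s @: P H)|.-1)%N.
  by apply: leq_trans; apply: leq_addr.
elim: H hH Hn => [|H IHH]; first by rewrite leqn0 => /eqP->; rewrite big_geq.
rewrite leq_eqVlt => /predU1P[<- _|hH Hn]; first by rewrite big_geq.
rewrite big_nat_recr //= addnAC; have {}IHH := IHH hH (ltnW Hn).
rewrite (sum_perm_remaining (Ordinal Hn)) /=.
suff -> : (\sum_(s : 'S_n) #|S (s @: P H.+1)|.-1 = \sum_(s : 'S_n) #|S (s @: P H)|.-1 +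
    \sum_(s : 'S_n) lam (S (s @: P H)) (a (s (Ordinal Hn))))%N.
  by rewrite mulnDr leq_add // leq_mul2r leq_subr orbT.
rewrite -big_split; apply: eq_bigr => s _ /=; rewrite (step s (Ordinal Hn)) /=.
by rewrite -!subn1 addnBAC // card_gt0 subset_sums_neq0.
Qed.

(** Average over all orderings and over the cut positions from [h] to [K * h]. The term with factor
    8 is averaged along with the growth so that the same [I] also has few sums; [incomplete_decode]
    draws [5 * #|S I| <= p] from it. *)
Lemma exists_prefix_small_growth (K h : nat) : (1 < K)%N -> (0 < h)%N ->
  (K * (K * h) <= n)%N -> exists I : {set 'I_n}, [/\ (h <= #|I|)%N, (#|I| < K * h)%N &
  (K.-1 * (\sum_(j | j \notin I) lam (S I) (a j) + 8 * #|S I|.-1) <= (K + 9) * p)%N].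
Proof.
move=> K1 h0 leKn; set H := (K * h)%N in leKn *.
have hH : (h <= H)%N by rewrite leq_pmull //; lia.
have Hn : (H <= n)%N by apply: leq_trans leKn; rewrite leq_pmull //; lia.
have H0 : (0 < H)%N by lia.
suff : exists s : 'S_n, exists2 i : nat, (h <= i < H)%N & 
   (K.-1 * (remaining_growth s i + 8 * #|S (s @: P i)|.-1) <= (K + 9) * p)%N.
  move=> [s [i /andP[hi iH] le]]; exists (s @: P i).
  have cP : #|s @: P i| = i.
    rewrite card_imset; last exact: perm_inj.
    rewrite -sum1_card (eq_bigl (fun j : 'I_n => (j < i)%N)); last by move=> j; rewrite inE.
    rewrite (big_ord_narrow (leq_trans (ltnW iH) Hn)) sum1_card card_ord //.
  split; rewrite ?cP //; apply: leq_trans le; rewrite leq_mul2l leq_add2r; apply/orP; right.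
  rewrite (reindex_inj (@perm_inj _ s)) /= /remaining_growth.
  rewrite (eq_bigl (fun j : 'I_n => (i <= j)%N)) // => j.
  by rewrite mem_imset ?inE -?leqNgt //; apply: perm_inj.
set q := (n %/ H)%N; set Y := (\sum_(s : 'S_n) #|S (s @: P H)|.-1)%N.
have Kq : (K <= q)%N by rewrite /q leq_divRL.
have qY : (q * Y <= n`! * p.-1)%N by apply: sum_perm_card_prefix; apply: leq_trunc_div.
have nq : (n <= q.+1 * H)%N by apply/ltnW/ltn_ceil.
have [/existsP[s /existsP[i /andP[hi le]]]|none] := boolP [exists s : 'S_n, exists i : 'I_H,
   (h <= i) && (K.-1 * (remaining_growth s i + 8 * #|S (s @: P i)|.-1) <= (K + 9) * p)]%N.
  by exists s; exists i; rewrite ?hi ?ltn_ord.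
(* A failing cut fails also with the larger prefix [P H], whose size does not depend on [i]; summing
   the failures will contradict the averages. *)
have big (s : 'S_n) (i : nat) : (h <= i < H)%N ->
    ((K + 9) * p <= K.-1 * (remaining_growth s i + 8 * #|S (s @: P H)|.-1))%N.
  move=> /andP[hi iH]; move: none; rewrite negb_exists => /forallP/(_ s).
  rewrite negb_exists => /forallP/(_ (Ordinal iH)); rewrite /= hi /= -ltnNge => /ltnW le.
  apply: leq_trans le _; rewrite leq_mul2l leq_add2l leq_mul2l /=; apply/orP; right.
  rewrite -!subn1 leq_sub2r // subset_leq_card // subset_sumsS // imsetS //.
  by apply/subsetP => j; rewrite !inE => /leq_trans; apply; apply: ltnW.
have sum1 : (n`! * ((H - h) * ((K + 9) * p)) <=
    \sum_(s : 'S_n) \sum_(h <= i < H)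
       K.-1 * (remaining_growth s i + 8 * #|S (s @: P H)|.-1))%N.
  rewrite -card_Sn -sum_nat_const; apply: leq_sum => s _.
  rewrite -sum_nat_const_nat big_nat_cond [leqRHS]big_nat_cond.
  by apply: leq_sum => i /andP[hiH _]; apply: big.
have sum2 : (\sum_(s : 'S_n) \sum_(h <= i < H)
       K.-1 * (remaining_growth s i + 8 * #|S (s @: P H)|.-1) =
     K.-1 * (\sum_(h <= i < H) \sum_(s : 'S_n) remaining_growth s i + (H - h) * (8 * Y)))%N.
  rewrite exchange_big /= -sum_nat_const_nat -big_split big_distrr; apply: eq_bigr => i _ /=.
  by rewrite -big_distrr big_split -big_distrr.
have sum3 := sum_perm_increments hH Hn.
have HhE : (H - h = K.-1 * h)%N by rewrite /H; nia.
set F := (\sum_(h <= i < H) _)%N in sum2 sum3.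
(* The 9 arises here: [K <= q] gives [q.+1 * K + 8 * K.-1 <= (K + 9) * q]. *)
have M1 : (n + 8 * (H - h) <= h * (K + 9) * q)%N.
  have : (n + 8 * (K.-1 * h) <= h * (q.+1 * K + 8 * K.-1))%N by rewrite /H in nq; lia.
  rewrite HhE; move/leq_trans; apply; rewrite -mulnA leq_mul2l; apply/orP; right.
  by rewrite mulSn; lia.
have hKq0 : (0 < h * (K + 9) * q)%N by rewrite !muln_gt0 h0 /=; lia.
have F2 : (F + (H - h) * (8 * Y) <= (n + 8 * (H - h)) * Y)%N by lia.
have F3 : (q * (F + (H - h) * (8 * Y)) <= (h * (K + 9) * q) * (n`! * p.-1))%N.
  apply: leq_trans (leq_mul (leqnn q) F2) _; rewrite mulnCA.
  exact: leq_mul M1 qY.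
have n0 := fact_gt0 n; have p0 := prime_gt0 p_pr.
have G : (h * (K + 9) * q * (n`! * p) <= h * (K + 9) * q * (n`! * p.-1))%N.
  apply: leq_trans F3; rewrite -(leq_pmul2l (_ : (0 < K.-1)%N)); last by lia.
  have := leq_mul (leqnn q) sum1; rewrite sum2 HhE.
  by move: (n`!) (F + _)%N => x y; lia.
by move: G; rewrite leq_pmul2l // leq_pmul2l //; lia.
Qed.

End Averaging.


From mathcomp Require Import finmap multiset.
From mathcomp Require Import all_classical.

(** * Encoding incomplete sequences *)

Definition seq_sums (V : finZmodType) (l : seq V) : {set V} :=
  \big[@sumset V/[set 0]]_(x <- l) [set 0; x].

Lemma mem_seq_sums (V : finZmodType) (l : seq V) x : x \in seq_sums l ->
  exists2 l', subseq l' l & x = \sum_(y <- l') y.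
Proof.
rewrite /seq_sums; elim: l x => [|y l IHl] x.
  by rewrite big_nil => /set1P->; exists [::]; rewrite ?big_nil.
rewrite big_cons => /imset2P[u v /set2P[]-> /IHl[l' sl ->] ->].
  by exists l'; rewrite ?add0r //; apply: subseq_trans sl (subseq_cons _ _).
by exists (y :: l'); rewrite ?big_cons //= eqxx.
Qed.

Lemma subset_sums_map (V : finZmodType) (T : finType) (a : T -> V) (I : {set T}) :
  subset_sums a I = seq_sums [seq a j | j <- enum I].
Proof. by rewrite /seq_sums big_map big_enum. Qed.

Lemma exists_padding (T : Type) (l : seq T) N : (size l <= N)%N ->
  exists w : N.-tuple (option T), pmap id w = l.
Proof.
move=> lN; have sz : size (map Some l ++ nseq (N - size l) None) == N.
  by rewrite size_cat size_map size_nseq subnKC.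
exists (Tuple sz) => /=; rewrite pmap_cat (map_pK (g := Some)) //.
by elim: (N - size l)%N => [|k IHk]; rewrite ?cats0.
Qed.

Definition multiplicity_seq (p m : nat) (g : {ffun 'F_p -> 'I_m.+1}) : seq 'F_p :=
  flatten [seq nseq (g x) x | x <- enum 'F_p].

Lemma count_multiplicity_seq (p m : nat) (g : {ffun 'F_p -> 'I_m.+1}) x :
  count_mem x (multiplicity_seq g) = g x.
Proof.
rewrite count_flatten -map_comp sumn_map big_enum /= (bigD1 x) //= big1 ?addn0.
  by rewrite count_nseq /= eqxx mul1n.
by move=> y /negbTE yx; rewrite count_nseq /= yx.
Qed.

(** The term [a] is set aside because [incomplete] admits only non-empty subsequences while
    [seq_sums] contains the empty sum: a full [seq_sums l] would write every [s] as [a] plus a sum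
    from [l]. *)
Lemma incomplete_seq_sums (p : nat) (a : 'F_p) (l : seq 'F_p) :
  incomplete (seq_mset (a :: l)) -> seq_sums l != [set: 'F_p]%SET.
Proof.
move=> inc; apply/eqP => lT; apply: inc; apply/seteqP; split => // s _.
have : s - a \in seq_sums l by rewrite lT inE.
move=> /mem_seq_sums[l' sl' sE]; exists (seq_mset (a :: l')); split.
- apply/msubsetP => x; rewrite !mset_seqE; apply: leq_count_subseq.
  by rewrite /= eqxx.
- move/msetP/(_ a); rewrite mset_seqE mset0E /= eqxx; lia.
- by rewrite (perm_big _ (perm_eq_seq_mset _)) big_cons -sE; apply/esym/subrKC.
Qed.

Section Counting.
Variables (p m : nat) (p_pr : prime p).

Lemma count_le_max_mult (A : {mset 'F_p}%mset) x : (A x <= max_mult A)%N.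
Proof. exact: leq_bigmax. Qed.

Definition growth_bounded (K : nat) (B : {set 'F_p}) : {set {ffun 'F_p -> 'I_m.+1}} :=
  [set g : {ffun 'F_p -> 'I_m.+1} |
    (K.-1 * \sum_x g x * lam B x <= (K + 9) * p)%N].

(* [(a, w, g)] stands for the sequence made of [a], of the short part [w] (padded with
   [None]) and of [g x] further copies of each [x]. *)
Definition codes (K h t : nat) :
    {set 'F_p * (K * h).-tuple (option 'F_p) * {ffun 'F_p -> 'I_m.+1}} :=
  [set c : 'F_p * (K * h).-tuple (option 'F_p) * {ffun 'F_p -> 'I_m.+1} |
    let B := seq_sums (pmap id c.1.2) in
    [&& (t ^ 2 <= #|B|)%N, (5 * #|B| <= p)%N & c.2 \in growth_bounded K B]].

Definition decode K h (c : 'F_p * (K * h).-tuple (option 'F_p) * {ffun 'F_p -> 'I_m.+1}) :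
    {mset 'F_p}%mset :=
  seq_mset (c.1.1 :: pmap id c.1.2 ++ multiplicity_seq c.2).

(** Set one term aside and cut the rest by [exists_prefix_small_growth]: [I] gives the short part,
    the multiplicities of the other terms give [g]. The short part has at least [h] terms, enough
    for [card_subset_sums_quadratic]. *)
Lemma incomplete_decode (K h t : nat) (A : {mset 'F_p}%mset) :
  (40 <= K)%N -> (24 < p)%N -> (0 < t)%N -> (m * (4 * t).+1 + 5 * t <= h)%N ->
  incomplete_seqs m p A -> (K * (K * h) < size A)%N ->
  exists2 c, c \in codes K h t & A = decode c.
Proof.
move=> K40 p24 t0 lth [incA maxA] ltA.
have := seq_mset_id A; case: (enum_mset A) ltA => // a l ltA AE.
rewrite -{}AE in incA maxA *.
have fib x : (count_mem x (a :: l) <= m)%N.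
  by apply: leq_trans maxA; rewrite -mset_seqE count_le_max_mult.
set b := tnth (in_tuple l).
have lE : l = [seq b j | j <- enum 'I_(size l)] by rewrite map_tnth_enum.
have ST : subset_sums b [set: 'I_(size l)]%SET != [set: 'F_p]%SET.
  rewrite subset_sums_map (eq_enum (_ : [set: 'I_(size l)]%SET =i 'I_(size l))) -?lE.
    exact: incomplete_seq_sums incA.
  by move=> j; rewrite inE.
have cE x : count_mem x l = (\sum_(j | b j == x) 1)%N.
  transitivity (count_mem x [seq b j | j <- enum 'I_(size l)]); first by rewrite -lE.
  by rewrite count_map -sum1_count big_enum_cond.
have fibI (I : {set 'I_(size l)}) x : (#|[set j in I | b j == x]| <= m)%N.
  suff le : (#|[set j in I | b j == x]| <= count_mem x l)%N.
    by apply: leq_trans le _; have /= := fib x; lia.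
  rewrite cE -sum1_card [leqRHS](bigID (fun j => j \in I)) /=; apply: leq_trans (leq_addr _ _).
  by rewrite (eq_bigl (fun j => (b j == x) && (j \in I))) // => j; rewrite inE andbC.
have [|||I [leI ltI gr]] := @exists_prefix_small_growth p p_pr _ b ST K h.
- by lia.
- by lia.
- by move: ltA => /=; lia.
have gr0 := card_subset_sums_quadratic p_pr (fibI I) (leq_trans lth leI).
(* The term with factor 8 bounds [#|subset_sums b I| - 1] by [(K + 9) * p / (8 * (K - 1))], at most
   [49 * p / 312] for [40 <= K]; [24 < p] leaves room for the 1. *)
have Ble : (5 * #|subset_sums b I| <= p)%N.
  have : (0 < #|subset_sums b I|)%N by rewrite card_gt0 subset_sums_neq0.
  move: gr; move: #|_| (\sum_(_ | _) _)%N => x y; clear -K40 p24; nia.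
have {gr0} leB : (t ^ 2 <= #|subset_sums b I|)%N by case: gr0 => //; rewrite ltnNge Ble.
have [|w wE] := @exists_padding _ [seq b j | j <- enum I] (K * h).
  by rewrite size_map -cardE ltnW.
pose l' := [seq b j | j <- enum (~: I)%SET].
have perml : perm_eq l ([seq b j | j <- enum I] ++ l').
  apply/allP => x _ /=; rewrite cE count_cat !count_map -!sum1_count !big_enum_cond /=.
  rewrite (bigID (fun j => j \in I)) /=; apply/eqP; congr (_ + _)%N.
    by apply: eq_bigl => j; rewrite andbC.
  by apply: eq_bigl => j; rewrite inE andbC.
have ltc x : (count_mem x l' < m.+1)%N.
  have /= := fib x; rewrite (seq.permP perml (pred1 x)) count_cat addnA ltnS.
  by apply: leq_trans; apply: leq_addl.
pose g : {ffun 'F_p -> 'I_m.+1} := [ffun x => Ordinal (ltc x)].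
exists (a, w, g).
  rewrite inE /= wE -subset_sums_map leB Ble inE /=.
  suff -> : (\sum_x g x * lam (subset_sums b I) x =
      \sum_(j | j \notin I) lam (subset_sums b I) (b j))%N.
    by apply: leq_trans gr; rewrite leq_mul2l leq_addr orbT.
  rewrite [RHS](partition_big b xpredT) //=; apply: eq_bigr => x _.
  rewrite (eq_bigr (fun=> lam (subset_sums b I) x)) => [|j /andP[_ /eqP->]] //.
  rewrite big_const iter_addn_0 mulnC ffunE /= count_map -sum1_count big_enum_cond sum1_card.
  by congr (_ * _)%N; apply: eq_card => j; rewrite -!topredE /= inE.
apply/eq_seq_msetP; rewrite /= perm_cons wE (perm_trans perml) // perm_cat2l.
by apply/allP => x _ /=; rewrite count_multiplicity_seq ffunE.
Qed.

Lemma card_codes (K h t W : nat) :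
  (forall B : {set 'F_p}, t ^ 2 <= #|B| -> 5 * #|B| <= p -> #|growth_bounded K B| <= W)%N ->
  (#|codes K h t| <= p * p.+1 ^ (K * h) * W)%N.
Proof.
move=> leW; rewrite -[X in (X * _ ^ _)%N](card_Fp p_pr).
have -> : p.+1 = #|{: option 'F_p}| by rewrite card_option card_Fp.
rewrite -card_tuple -card_prod -sum_nat_const -sum1_card big_mkcond.
rewrite (eq_bigr (fun c => if (c.1, c.2) \in codes K h t then 1 else 0)%N) => [|[u g] _] //.
rewrite -(pair_bigA _ (fun u g => if (u, g) \in codes K h t then 1 else 0)%N) /=.
apply: leq_sum => u _; rewrite -big_mkcond /=; set B := seq_sums (pmap id u.2).
rewrite (eq_bigl (fun g => [&& t ^ 2 <= #|B|, 5 * #|B| <= p &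
  g \in growth_bounded K B])%N) => [|g]; last by rewrite inE.
have [tB|tB] := leqP (t ^ 2) #|B|; last by rewrite big_pred0.
have [pB|pB] := leqP (5 * #|B|) p; last by rewrite big_pred0.
by rewrite sum1_card leW.
Qed.

(** Sequences with at most [K * (K * h)] terms are counted crudely as padded tuples; the longer ones
    are decoded from [codes]. *)
Lemma N2_upper (K h t W : nat) :
  (40 <= K)%N -> (24 < p)%N -> (0 < t)%N -> (m * (4 * t).+1 + 5 * t <= h)%N ->
  (forall B : {set 'F_p}, t ^ 2 <= #|B| -> 5 * #|B| <= p -> #|growth_bounded K B| <= W)%N ->
  (N2 m p <= p.+1 ^ (K * (K * h)) + p * p.+1 ^ (K * h) * W)%N.
Proof.
move=> K40 p24 t0 lth leW.
pose F1 := ([fset seq_mset (pmap id (val w)) | w : (K * (K * h)).-tuple (option 'F_p)])%fset.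
pose F2 := ([fset decode c | c in codes K h t])%fset.
have sF : (fset_set (incomplete_seqs m p) `<=` F1 `|` F2)%fset.
  apply/fsubsetP => /= A; rewrite in_fset_set; last exact: finite_incomplete_seqs.
  rewrite inE => incA; rewrite inE.
  have [ltA|leA] := ltnP (K * (K * h)) (size (A : {mset 'F_p}%mset)).
    have [c cc ->] := incomplete_decode K40 p24 t0 lth incA ltA.
    by apply/orP; right; apply: in_imfset.
  have [w wE] := exists_padding leA; apply/orP; left; apply/imfsetP; exists w => //=.
  by rewrite wE seq_mset_id.
apply: leq_trans (fsubset_leq_card sF) _; apply: leq_trans (leq_card_fsetU _ _) _.
apply: leq_add; last first.
  apply: leq_trans (leq_imfset_card _ _ _) _; apply: leq_trans (card_codes h leW).
  by rewrite cardE.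
apply: leq_trans (leq_imfset_card _ _ _) _.
by rewrite /= -cardE card_tuple card_option card_Fp.
Qed.

End Counting.


From mathcomp Require Import all_reals all_analysis.
Import Order.TTheory GRing.Theory Num.Theory.
Import numFieldNormedType.Exports.

(** * The Basel sum *)

Local Open Scope classical_set_scope.
Local Open Scope ring_scope.

Section Basel.
Variable R : realType.
Implicit Types x : R.

Lemma sin_le_id x : 0 < x < pi / 2 -> sin x <= x.
Proof.
move=> /andP[x0 xpi].
have [|c /[!in_itv]/= /andP[c0 cx]] := @MVT R sin cos 0 x x0 (fun y _ => is_derive_sin y).
- exact/continuous_subspaceT/continuous_sin.
- by rewrite sin0 !subr0 => ->; rewrite ler_piMl ?cos_le1 // ltW.
Qed.

Lemma le_id_tan x : 0 < x < pi / 2 -> x <= tan x.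
Proof.
move=> /andP[x0 xpi].
have pos y : 0 <= y <= x -> 0 < cos y.
  move=> /andP[y0 yx]; rewrite cos_gt0_pihalf //.
  by rewrite (lt_le_trans _ y0) ?oppr_lt0 ?divr_gt0 ?pi_gt0 //= (le_lt_trans yx).
have [y||c /[!in_itv]/= /andP[c0 cx]] := @MVT R tan (fun x => (cos x) ^-2) 0 x x0.
- rewrite in_itv /= => /andP[y0 yx]; apply: is_derive_tan.
  by rewrite gt_eqF // pos // !ltW.
- apply/continuous_in_subspaceT => y; rewrite inE /= in_itv /= => yx.
  by apply: continuous_tan; rewrite gt_eqF // pos.
- rewrite tan0 !subr0 => ->; rewrite ler_peMl ?(ltW x0) //.
  have cc : 0 < cos c by apply: pos; rewrite !ltW.
  by rewrite invf_ge1 ?exprn_gt0 // exprn_ile1 ?cos_le1 // ltW.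
Qed.

(** From [sin x <= x <= tan x], as the inverse square of the sine is 1 plus the squared
    cotangent. *)
Lemma sin_inv_sqr_bounds x : 0 < x < pi / 2 ->
  x ^- 2 <= (sin x) ^- 2 <= x ^- 2 + 1.
Proof.
move=> xpi; have s0 := sin_gt0_pihalf xpi; have sx := sin_le_id xpi.
have tx := le_id_tan xpi; case/andP: xpi => x0 xpi.
have c0 : 0 < cos x.
  by rewrite cos_gt0_pihalf // xpi andbT (lt_trans _ x0) // oppr_lt0 divr_gt0 // pi_gt0.
rewrite lef_pV2 ?posrE ?exprn_gt0 // ler_sqr ?nnegrE ?(ltW s0) ?(ltW x0) // sx /=.
have -> : (sin x) ^- 2 = (cos x / sin x) ^+ 2 + 1.
  by rewrite expr_div_n cos2sin2 mulrBl mul1r divff ?subrK // expf_neq0 // gt_eqF.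
have ct0 : 0 < cos x / sin x by rewrite divr_gt0.
rewrite lerD2r -exprVn ler_sqr ?nnegrE ?invr_ge0 ?(ltW ct0) ?(ltW x0) //.
by rewrite -[cos x / sin x]invrK lef_pV2 ?posrE ?invr_gt0 ?divr_gt0 // invf_div.
Qed.

(** Rescaled by [pi ^ 2 / (4 * M ^ 2)] this approximates the Basel sum, and doubling evaluates it
    when [M] is a power of 2. *)
Definition csc_sum (M : nat) : R :=
  \sum_(1 <= k < M) (sin (k%:R * (pi / (2 * M%:R)))) ^- 2.

(* Pair the angles [y] and [pi / 2 - y] and use [sin^-2 y + cos^-2 y = 4 sin^-2 (2 y)]. *)
Lemma csc_sum_double M : (0 < M)%N -> csc_sum (2 * M) = 4 * csc_sum M + 2.
Proof.
move=> M0; rewrite /csc_sum.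
have MR : (M%:R : R) != 0 by rewrite pnatr_eq0 -lt0n.
set f := fun k : nat => (sin (k%:R * (pi / (2 * (2 * M)%:R))) ^- 2 : R).
transitivity (\sum_(1 <= k < 2 * M) f k); first by [].
rewrite (@big_cat_nat _ _ _ M) //=; last by rewrite leq_pmull.
rewrite [X in _ + X]big_ltn; last by rewrite mul2n -addnn -[X in (X < _)%N]addn0 ltn_add2l.
have -> : \sum_(M.+1 <= k < 2 * M) f k = \sum_(1 <= k < M) f (2 * M - k)%N.
  rewrite big_nat_rev /= -[X in \sum_(X <= _ < _) _]add1n big_addn.
  rewrite mul2n -addnn addnK; apply: eq_bigr => k _; congr f; lia.
(* The middle angle [pi / 4] is its own partner and accounts for the constant 2. *)
have -> : f M = 2.
  rewrite /f natrM (_ : _ * _ = pi / 4); last by field.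
  have := @cos_mulr2n R (pi / 4); rewrite (_ : pi / 4 *+ 2 = pi / 2); last by lra.
  rewrite cos_pihalf => c2; have {}c2 : sin (pi / 4) ^+ 2 = 2^-1 :> R.
    by rewrite sin2cos2; move: c2; rewrite -mulr_natr; lra.
  by rewrite c2 invrK.
rewrite addrCA addrC -big_split /= mulr_sumr; congr (_ + _).
rewrite big_nat_cond [RHS]big_nat_cond; apply: eq_bigr => k /andP[/andP[k0 kM] _].
have kR : 0 < (k%:R / M%:R : R) < 1.
  by rewrite divr_gt0 ?ltr0n //= ltr_pdivrMr ?ltr0n // mul1r ltr_nat.
have pi0 := @pi_gt0 R.
pose y : R := k%:R / M%:R * (pi / 4).
have -> : k%:R * (pi / (2 * M%:R)) = y *+ 2 by rewrite /y -mulr_natr; field.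
rewrite /f natrM (_ : k%:R * _ = y); last by rewrite /y; field.
rewrite natrB ?natrM; last by rewrite (leq_trans (ltnW kM)) // leq_pmull.
rewrite (_ : _ * (pi / _) = pi / 2 - y); last by rewrite /y; field.
rewrite sinB sin_pihalf cos_pihalf mul1r mul0r subr0 sin_mulr2n -mulr_natr.
have ypi : 0 < y < pi / 2 by rewrite /y; nra.
have s0 := sin_gt0_pihalf ypi.
have c0 : 0 < cos y by rewrite cos_gt0_pihalf //; lra.
have := @cos2Dsin2 R y => cs1.
transitivity (((cos y) ^+ 2 + (sin y) ^+ 2) * ((cos y) ^- 2 * (sin y) ^- 2)).
  by field; rewrite !gt_eqF.
by rewrite cs1; field; rewrite !gt_eqF.
Qed.

Lemma csc_sum_exp2 n : csc_sum (2 ^ n) = 2 / 3 * ((2 ^ n)%:R ^+ 2 - 1).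
Proof.
elim: n => [|n IHn]; first by rewrite /csc_sum big_geq // expn0 expr1n subrr mulr0.
by rewrite expnS csc_sum_double ?expn_gt0 // IHn natrM; field.
Qed.

(** Rescale [sin_inv_sqr_bounds] at the angles [k * pi / (2 * M)]: the additive errors 1 of fewer
    than [M] terms total at most [pi ^ 2 / (4 * M)]. *)
Lemma sum_inv_sqr_csc M : (0 < M)%N ->
  \sum_(1 <= k < M) (k%:R ^- 2 : R) <= (pi ^+ 2 / (4 * M%:R ^+ 2) * csc_sum M : R)
  <= \sum_(1 <= k < M) (k%:R ^- 2 : R) + pi ^+ 2 / (4 * M%:R).
Proof.
move=> M0; have MR : 0 < M%:R :> R by rewrite ltr0n.
have pi0 := @pi_gt0 R.
have term k : (0 < k < M)%N -> (k%:R ^- 2 : R) <=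
    (pi ^+ 2 / (4 * M%:R ^+ 2) * (sin (k%:R * (pi / (2 * M%:R)))) ^- 2 : R)
    <= k%:R ^- 2 + pi ^+ 2 / (4 * M%:R ^+ 2).
  move=> /andP[k0 kM]; have kR : 0 < k%:R :> R by rewrite ltr0n.
  have kM' : k%:R < M%:R :> R by rewrite ltr_nat.
  have [|lo hi] := andP (@sin_inv_sqr_bounds (k%:R * (pi / (2 * M%:R))) _).
    rewrite (_ : k%:R * (pi / (2 * M%:R)) = k%:R / M%:R * (pi / 2)); last by field; rewrite gt_eqF.
    by rewrite mulr_gt0 ?divr_gt0 //= gtr_pMl ?divr_gt0 // ltr_pdivrMr // mul1r.
  have c0 : 0 < pi ^+ 2 / (4 * M%:R ^+ 2) :> R by rewrite divr_gt0 ?mulr_gt0 ?exprn_gt0.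
  have E : pi ^+ 2 / (4 * M%:R ^+ 2) * (k%:R * (pi / (2 * M%:R))) ^- 2 = k%:R ^- 2 :> R.
    by move: (pi : R) pi0 => P P0; field; rewrite !gt_eqF.
  rewrite -E ler_pM2l // lo /=.
  by rewrite -[X in _ + X]mulr1 -mulrDr ler_pM2l.
rewrite /csc_sum mulr_sumr; apply/andP; split.
  by rewrite big_nat_cond [leRHS]big_nat_cond; apply: ler_sum => k /andP[/term/andP[]].
apply: (@le_trans _ _ (\sum_(1 <= k < M) (k%:R ^- 2 + pi ^+ 2 / (4 * M%:R ^+ 2)))).
  by rewrite big_nat_cond [leRHS]big_nat_cond; apply: ler_sum => k /andP[/term/andP[]].
rewrite big_split /= lerD2l sumr_const_nat -[leLHS]mulr_natr.
rewrite (_ : pi ^+ 2 / (4 * M%:R) = pi ^+ 2 / (4 * M%:R ^+ 2) * M%:R); last first.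
  by field; rewrite gt_eqF.
by rewrite ler_pM2l ?divr_gt0 ?mulr_gt0 ?exprn_gt0 // ler_nat leq_subr.
Qed.

Lemma sum_inv_sqr_le L : \sum_(l < L) (l.+1%:R ^- 2 : R) <= pi ^+ 2 / 6.
Proof.
pose M := (2 ^ L.+1)%N; have M0 : (0 < M)%N by rewrite expn_gt0.
have MR : 0 < M%:R :> R by rewrite ltr0n.
have LM : (L.+1 <= M)%N by apply/ltnW/ltn_expl.
have [lo _] := andP (sum_inv_sqr_csc M0).
apply: le_trans (le_trans lo _).
  rewrite (@big_cat_nat _ _ _ L.+1) //= -[leLHS]addr0; apply: lerD.
    by rewrite big_add1 /= big_mkord.
  by apply: sumr_ge0 => k _; rewrite invr_ge0 exprn_ge0.
rewrite /M csc_sum_exp2 -/M.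
rewrite (_ : _ * _ = pi ^+ 2 / 6 * (1 - M%:R ^- 2)); last by field; rewrite gt_eqF.
rewrite ler_piMr ?divr_ge0 ?exprn_ge0 ?pi_ge0 //.
Qed.

Lemma sum_inv_sqr_ge (d : R) : 0 < d -> exists L,
  pi ^+ 2 / 6 - d <= \sum_(l < L) (l.+1%:R ^- 2 : R).
Proof.
move=> d0; set c : R := pi ^+ 2 / 6 + pi ^+ 2 / 4.
have c0 : 0 < c by rewrite addr_gt0 ?divr_gt0 ?exprn_gt0 ?pi_gt0.
pose n := (Num.truncn (c / d)).+1; pose M := (2 ^ n)%N.
have M0 : (0 < M)%N by rewrite expn_gt0.
have MR : 1 <= M%:R :> R by rewrite ler1n.
have cd : c / M%:R <= d.
  rewrite ler_pdivrMr ?(lt_le_trans _ MR) // -ler_pdivrMl // mulrC.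
  apply: ltW; apply: lt_le_trans (truncnS_gt _) _.
  by rewrite ler_nat ltnW // ltn_expl.
have [_ hi] := andP (sum_inv_sqr_csc M0).
exists M.-1; have -> : \sum_(l < M.-1) (l.+1%:R ^- 2 : R) = \sum_(1 <= k < M) (k%:R ^- 2 : R).
  by rewrite big_add1 big_mkord.
move: hi; rewrite /M csc_sum_exp2 -/M => hi.
have iM : 0 < M%:R^-1 :> R by rewrite invr_gt0 (lt_le_trans _ MR).
have iM1 : M%:R^-1 <= 1 :> R by rewrite invf_le1 ?(lt_le_trans _ MR).
have E : pi ^+ 2 / (4 * M%:R ^+ 2) * (2 / 3 * (M%:R ^+ 2 - 1)) =
    pi ^+ 2 / 6 * (1 - M%:R^-1 ^+ 2) :> R.
  by field; rewrite gt_eqF // (lt_le_trans _ MR).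
rewrite E in hi.
have E2 : pi ^+ 2 / (4 * M%:R) = pi ^+ 2 / 4 * M%:R^-1 :> R.
  by field; rewrite gt_eqF // (lt_le_trans _ MR).
rewrite E2 in hi.
have pi2 : 0 < pi ^+ 2 / 6 :> R by rewrite divr_gt0 ?exprn_gt0 ?pi_gt0.
move: cd hi; rewrite /c mulrDl; move: (M%:R^-1) iM iM1 => x x0 x1.
move: (\sum_(_ <= _ < _) _) (pi ^+ 2 / 6) pi2 (pi ^+ 2 / 4) => s a a0 b cd hi.
have : a * x ^+ 2 <= a * x by rewrite ler_pM2l // expr2 ler_piMr // ltW.
by lra.
Qed.

End Basel.

(** * The generating function *)

Section LogSums.
Variable R : realType.
Implicit Types (s x t : R).

(** Taylor expansion with remainder: the polynomial part of [f] differentiates to a geometric sum,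
    so the derivative of [f] collapses to [- ((1 - w) ^ L / w)], and the mean value theorem applies
    on [[1 - x, 1]]. *)
Lemma ln1B_expansion (L : nat) x : 0 <= x < 1 ->
  \sum_(l < L) x ^+ l.+1 / l.+1%:R <= - ln (1 - x)
  <= \sum_(l < L) x ^+ l.+1 / l.+1%:R + x ^+ L.+1 / (1 - x).
Proof.
move=> /andP[x0 x1]; have [->|xN0] := eqVneq x 0.
  rewrite big1 ?subr0 ?ln1 ?oppr0 ?expr0n ?mul0r ?addr0 ?lexx // => l _.
  by rewrite expr0n mul0r.
have {xN0} x0 : 0 < x by rewrite lt_neqAle eq_sym xN0.
pose f : R -> R := (- @ln R) - \sum_(l < L) (l.+1%:R^-1 *: (cst 1 - id) ^+ l.+1).
have fE w : f w = - ln w - \sum_(l < L) (1 - w) ^+ l.+1 / l.+1%:R.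
  rewrite /f /= !fctE fct_sumE; congr (_ - _); apply: eq_bigr => l _.
  by rewrite !fctE mulrC.
have df (w : R) : 0 < w -> is_derive w 1 f (- ((1 - w) ^+ L / w)).
  move=> w0; have -> : - ((1 - w) ^+ L / w) = - w^-1 - \sum_(l < L) (l.+1%:R^-1 *:
      ((l.+1%:R * (1 - w) ^+ l) *: (0 - 1 : R))).
    have -> : \sum_(l < L) (l.+1%:R^-1 *: ((l.+1%:R * (1 - w) ^+ l) *: (0 - 1 : R))) =
        - \sum_(l < L) (1 - w) ^+ l.
      rewrite -sumrN; apply: eq_bigr => l _.
      by rewrite /GRing.scale /= sub0r mulrN1 mulrN mulKf ?pnatr_eq0.
    have E := subrX1 (1 - w) L.
    have E2 : (1 - w) ^+ L = 1 - w * \sum_(l < L) (1 - w) ^+ l.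
      by move: E; rewrite (_ : 1 - w - 1 = - w) ?mulNr; [lra | ring].
    by rewrite E2; field; rewrite gt_eqF.
  have d2 (l : 'I_L) : is_derive w 1 (l.+1%:R^-1 *: (cst 1 - id : R -> R) ^+ l.+1)
      (l.+1%:R^-1 *: ((l.+1%:R * (1 - w) ^+ l) *: (0 - 1 : R))).
    by apply: is_deriveZ; apply: is_deriveX.
  apply: is_deriveB; first by apply: is_deriveN; apply: is_derive1_ln.
have xx : 1 - x < 1 by rewrite ltrBlDr ltrDl.
have x1' : 0 < 1 - x by rewrite subr_gt0.
have [w|| c] := @MVT R f (fun w => - ((1 - w) ^+ L / w)) (1 - x) 1 xx.
- by rewrite in_itv /= => /andP[w1 _]; apply: df; apply: lt_trans w1.
- apply: derivable_within_continuous => w; rewrite in_itv /= => /andP[w1 _].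
  by apply: ex_derive; apply: df; apply: lt_le_trans w1.
rewrite in_itv /= => /andP[xc c1].
have -> : f 1 = 0.
  by rewrite fE ln1 oppr0 sub0r big1 ?oppr0 // => l _; rewrite subrr expr0n mul0r.
rewrite fE subKr sub0r mulNr => /oppr_inj E.
have c0 : 0 < c by apply: lt_trans xc.
have d0 : 0 < 1 - c by rewrite subr_gt0.
have ge0 : 0 <= (1 - c) ^+ L / c * x by rewrite mulr_ge0 ?divr_ge0 ?exprn_ge0 // ltW.
have le : (1 - c) ^+ L / c * x <= x ^+ L.+1 / (1 - x).
  rewrite exprSr mulrAC ler_pM ?mulr_ge0 ?exprn_ge0 ?invr_ge0 ?(ltW c0) ?(ltW x0) ?(ltW d0) //.
    rewrite ler_pM2r // lerXn2r ?nnegrE ?(ltW x0) ?(ltW d0) //; lra.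
  by rewrite lef_pV2 ?posrE // ltW.
by lra.
Qed.

Lemma geometric_expR (U : nat) t : 0 < t ->
  (\sum_(u < U) expR (- (t * u.+1%:R))) * (1 - expR (- t)) =
  expR (- t) * (1 - expR (- (t * U%:R))).
Proof.
move=> t0; set y := expR (- t).
have yE u : expR (- (t * u%:R)) = y ^+ u by rewrite -mulNr expRM_natr.
under eq_bigr do rewrite yE exprS.
rewrite yE -mulr_sumr -mulrA; congr (_ * _).
by rewrite -[1 - y]opprB mulrN mulrC -subrX1 opprB.
Qed.

Lemma geometric_expR_le (U : nat) t : 0 < t ->
  \sum_(u < U) expR (- (t * u.+1%:R)) <= t^-1.
Proof.
move=> t0; have := geometric_expR U t0; set S := \sum_(_ < _) _ => E.
have S0 : 0 <= S by apply: sumr_ge0 => *; apply: expR_ge0.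
have y0 := expR_gt0 (- t); have yU := expR_gt0 (- (t * U%:R)).
have := expR_ge1Dx t; rewrite -[expR t]invrK -expRN => H.
have {}H : (1 + t) * expR (- t) <= 1 by rewrite -ler_pdivlMr // div1r.
rewrite -div1r ler_pdivlMr //.
move: E H; move: (expR (- t)) y0 (expR (- (t * U%:R))) yU => y y0 z z0 E H.
have : S * t * y <= S * (1 - y) by rewrite -mulrA ler_wpM2l //; lra.
rewrite E => H2.
by rewrite -(ler_pM2r y0) mul1r; nra.
Qed.

Lemma exists_expR_le s (e : R) : 0 < s -> 0 < e -> exists L : nat, expR (- (s * L%:R)) <= e.
Proof.
move=> s0 e0; exists (Num.truncn ((s * e)^-1)).+1; set L := _.+1.
have L0 : (s * e)^-1 < L%:R := truncnS_gt _.
have LR : 0 < s * L%:R by rewrite mulr_gt0 // ltr0n.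
rewrite expRN; apply: (@le_trans _ _ (s * L%:R)^-1).
  rewrite lef_pV2 ?posrE ?expR_gt0 //; have := expR_ge1Dx (s * L%:R); lra.
rewrite -[e]invrK lef_pV2 ?posrE ?invr_gt0 //.
rewrite invfM in L0; rewrite -(ler_pM2l (_ : 0 < s^-1)) ?invr_gt0 // mulrA mulVf ?gt_eqF //.
by rewrite mul1r ltW.
Qed.

(** The logarithm at [exp (- s)] of Euler's partition product, restricted to parts of size at most
    [U]. *)
Definition log_sum (U : nat) s : R := \sum_(u < U) - ln (1 - expR (- (s * u.+1%:R))).

Lemma expR_itv s (u : nat) : 0 < s -> 0 <= expR (- (s * u.+1%:R)) < 1.
Proof. by move=> s0; rewrite expR_ge0 expR_lt1 oppr_lt0 mulr_gt0. Qed.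

Lemma double_sum_swap L U s :
  \sum_(u < U) \sum_(l < L) expR (- (s * u.+1%:R)) ^+ l.+1 / l.+1%:R =
  \sum_(l < L) l.+1%:R^-1 * \sum_(u < U) expR (- (s * l.+1%:R * u.+1%:R)).
Proof.
rewrite exchange_big; apply: eq_bigr => l _; rewrite mulr_sumr; apply: eq_bigr => u _.
by rewrite mulrC -expRM_natr mulNr mulrAC.
Qed.

(** Expand the logarithms to order [L] and exchange sums: the inner geometric sums are at most
    [1 / (s * l)], which leaves the Basel sum over [s]. For fixed [U] the remainders vanish as [L]
    grows. *)
Lemma log_sum_le (U : nat) s : 0 < s -> s * log_sum U s <= pi ^+ 2 / 6.
Proof.
move=> s0; rewrite mulrC -ler_pdivlMr //; apply/ler_addgt0Pr => e e0.
set q := expR (- s).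
have q1 : 0 < 1 - q by rewrite subr_gt0 expR_lt1 oppr_lt0.
have [L HL] : exists L : nat, expR (- (s * L%:R)) <= e * (1 - q) / U.+1%:R.
  by apply: exists_expR_le => //; rewrite divr_gt0 ?mulr_gt0.
have up : log_sum U s <= \sum_(u < U) (\sum_(l < L) expR (- (s * u.+1%:R)) ^+ l.+1 / l.+1%:R
    + expR (- (s * L%:R)) / (1 - q)).
  apply: ler_sum => u _; have /andP[_] := ln1B_expansion L (expR_itv u s0).
  have q0 : 0 < 1 - expR (- (s * u.+1%:R)) by have := expR_itv u s0; lra.
  move/le_trans; apply; rewrite lerD2l ler_pM ?exprn_ge0 ?expR_ge0 ?invr_ge0 ?(ltW q0) //.
    rewrite -expRM_natr ler_expR mulNr lerN2 -mulrA ler_pM2l // -natrM ler_nat mulSn.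
    by rewrite (leq_trans (leqnSn L)) // leq_addr.
  by rewrite lef_pV2 ?posrE // lerD2l lerN2 ler_expR lerN2 ler_peMr ?(ltW s0) // ler1n.
apply: le_trans up _; rewrite big_split /= double_sum_swap; apply: lerD.
  apply: (@le_trans _ _ (\sum_(l < L) l.+1%:R^-1 * (s * l.+1%:R)^-1)).
    apply: ler_sum => l _; rewrite ler_wpM2l ?invr_ge0 //.
    by apply: geometric_expR_le; rewrite mulr_gt0.
  have := sum_inv_sqr_le R L; rewrite -(ler_pM2r (_ : 0 < s^-1)) ?invr_gt0 //.
  apply: le_trans; rewrite mulr_suml; apply: ler_sum => l _.
  by rewrite invfM mulrA mulrAC -invfM -expr2.
rewrite sumr_const card_ord -[leLHS]mulr_natr.
have HL' : expR (- (s * L%:R)) / (1 - q) <= e / U.+1%:R by rewrite ler_pdivrMr // mulrAC.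
apply: le_trans (ler_wpM2r (ler0n _ U) HL') _.
by rewrite mulrAC ler_pdivrMr // ler_wpM2l ?(ltW e0) // ler_nat.
Qed.

(** Keep [L] terms of each logarithm. The full geometric series of ratio [exp (- t)] is at least
    [1 / t - 1]; cutting it at [U] leaves at least the fraction [1 - exp (- (s * U))]. *)
Lemma log_sum_ge (L U : nat) s : 0 < s ->
  (1 - expR (- (s * U%:R))) * (\sum_(l < L) l.+1%:R ^- 2 - s * L%:R) <= s * log_sum U s.
Proof.
move=> s0; have lo : \sum_(u < U) \sum_(l < L) expR (- (s * u.+1%:R)) ^+ l.+1 / l.+1%:R <=
    log_sum U s.
  by apply: ler_sum => u _; have /andP[] := ln1B_expansion L (expR_itv u s0).
apply: le_trans (ler_wpM2l (ltW s0) lo); rewrite double_sum_swap.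
have -> : s * L%:R = \sum_(l < L) s by rewrite sumr_const card_ord mulr_natr.
rewrite -sumrB !mulr_sumr; apply: ler_sum => l _.
have l0 : 0 < l.+1%:R :> R by rewrite ltr0n.
have t0 : 0 < s * l.+1%:R by rewrite mulr_gt0.
have U1 : 0 <= 1 - expR (- (s * U%:R)).
  by rewrite subr_ge0 expR_le1 oppr_le0 mulr_ge0 // ltW.
have y0 := expR_gt0 (- (s * l.+1%:R)).
have y1 : 0 < 1 - expR (- (s * l.+1%:R)) by rewrite subr_gt0 expR_lt1 oppr_lt0.
have ge : (1 - expR (- (s * U%:R))) * ((s * l.+1%:R)^-1 - 1) <=
    \sum_(u < U) expR (- (s * l.+1%:R * u.+1%:R)).
  have E := geometric_expR U t0; rewrite -(ler_pM2r y1) E.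
  have H1 : ((s * l.+1%:R)^-1 - 1) * (1 - expR (- (s * l.+1%:R))) <=
      expR (- (s * l.+1%:R)).
    have := expR_ge1Dx (- (s * l.+1%:R)).
    move: (expR _) y0 y1 => y y0 y1; move: (s * _) t0 => t t0 H.
    have : (1 - y) / t <= 1 by rewrite ler_pdivrMr // mul1r; lra.
    by lra.
  have H2 : 1 - expR (- (s * U%:R)) <= 1 - expR (- (s * l.+1%:R * U%:R)).
    rewrite lerD2l lerN2 ler_expR lerN2 ler_wpM2r // ler_peMr ?(ltW s0) //.
    by rewrite ler1n.
  rewrite -[leLHS]mulrA; apply: le_trans (ler_wpM2l U1 H1) _.
  by rewrite mulrC ler_wpM2l // ltW.
apply: le_trans (ler_wpM2l (ltW s0) (ler_wpM2l (_ : 0 <= l.+1%:R^-1) ge)); last first.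
  by rewrite invr_ge0 ltW.
have l1 : l.+1%:R^-1 <= 1 :> R by rewrite invf_le1 // ler1n.
move: (1 - _) U1 => W W0.
have -> : s * (l.+1%:R^-1 * (W * ((s * l.+1%:R)^-1 - 1))) = W * (l.+1%:R ^- 2 - l.+1%:R^-1 * s).
  by field; rewrite !gt_eqF.
by rewrite ler_wpM2l // lerD2l lerN2 ler_piMl ?(ltW s0).
Qed.

Lemma log_sum_asymptotic (d : R) : 0 < d -> exists s1 M0 : R, [/\ 0 < s1, 0 < M0 &
  forall (U : nat) s, 0 < s <= s1 -> M0 <= s * U%:R -> pi ^+ 2 / 6 - d <= s * log_sum U s].
Proof.
move=> d0; set z : R := pi ^+ 2 / 6.
have z0 : 0 < z by rewrite divr_gt0 ?exprn_gt0 ?pi_gt0.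
have d3 : 0 < d / 3 by rewrite divr_gt0.
have [L HL] := sum_inv_sqr_ge d3; have HL' := sum_inv_sqr_le R L.
(* A third of [d] each goes to the tail of the Basel sum, to [s * L], and to the truncation at [U],
   through [exp (- x) <= 1 / x]. *)
exists (d / 3 / L.+1%:R), (3 * z / d); split; first by rewrite divr_gt0.
  by rewrite divr_gt0 // mulr_gt0.
move=> U s /andP[s0 s1] HU; apply: le_trans (log_sum_ge L U s0).
have sL : s * L%:R <= d / 3.
  move: s1; rewrite ler_pdivlMr // => /(le_trans _); apply.
  by rewrite ler_wpM2l ?(ltW s0) // ler_nat.
have sL0 : 0 <= s * L%:R by rewrite mulr_ge0 // ltW.
have eU : expR (- (s * U%:R)) * z <= d / 3.
  have U0 : 0 < s * U%:R.
    by apply: (lt_le_trans _ HU); rewrite divr_gt0 // mulr_gt0.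
  rewrite expRN mulrC ler_pdivrMr ?expR_gt0 //.
  rewrite ler_pdivrMr // in HU.
  have : s * U%:R * d <= expR (s * U%:R) * d.
    by rewrite ler_pM2r //; have := expR_ge1Dx (s * U%:R); lra.
  by lra.
have e0 := expR_gt0 (- (s * U%:R)).
rewrite -/z in HL HL'; move: (\sum_(_ < _) _) HL HL' => S HL HL'.
have : expR (- (s * U%:R)) * (S - s * L%:R) <= expR (- (s * U%:R)) * z.
  by rewrite ler_pM2l //; lra.
by lra.
Qed.

Definition phi (m : nat) (u : R) : R := \sum_(i < m.+1) expR (- (i%:R * u)).

Lemma phi_gt0 m u : 0 < phi m u.
Proof.
rewrite /phi big_ord_recl ltr_wpDr ?expR_gt0 //.
by apply: sumr_ge0 => i _; apply: expR_ge0.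
Qed.

Lemma phi_ge1 m u : 1 <= phi m u.
Proof.
rewrite /phi big_ord_recl mul0r oppr0 expR0 lerDl.
by apply: sumr_ge0 => i _; apply: expR_ge0.
Qed.

Lemma phi0 m : phi m 0 = m.+1%:R.
Proof.
rewrite /phi (eq_bigr (fun=> 1)) => [|i _]; last by rewrite mulr0 oppr0 expR0.
by rewrite sumr_const card_ord.
Qed.

Lemma phi_nincr m u v : u <= v -> phi m v <= phi m u.
Proof. by move=> uv; apply: ler_sum => i _; rewrite ler_expR lerN2 ler_wpM2l. Qed.

Lemma ln_phi_ge0 m u : 0 <= ln (phi m u).
Proof. by apply: ln_ge0; apply: phi_ge1. Qed.

Lemma ln_phi_le m u : 0 <= u -> ln (phi m u) <= m%:R * expR (- u).
Proof.
move=> u0; rewrite -[phi m u](subrKC 1) ; apply: le_trans (le_ln1Dx _) _.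
  by rewrite ltrBrDl subrr phi_gt0.
rewrite /phi big_ord_recl mul0r oppr0 expR0 addrC addKr.
rewrite mulr_natl -[m in _ *+ m]card_ord -sumr_const; apply: ler_sum => i _.
by rewrite ler_expR lerN2 lift0 ler_peMl // ler1n.
Qed.

Lemma ln_phiE m u : 0 < u ->
  ln (phi m u) = - ln (1 - expR (- u)) + ln (1 - expR (- (m.+1%:R * u))).
Proof.
move=> u0; have u1 : 0 < 1 - expR (- u) by rewrite subr_gt0 expR_lt1 oppr_lt0.
have E : 1 - expR (- (m.+1%:R * u)) = phi m u * (1 - expR (- u)).
  have pE i : expR (- (i%:R * u)) = expR (- u) ^+ i by rewrite -mulrN expRM_natl.
  rewrite /phi pE; under eq_bigr do rewrite pE.
  by rewrite -[1 - expR (- u)]opprB mulrN mulrC -subrX1 opprB.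
by rewrite E lnM ?posrE ?phi_gt0 // addrC addrK.
Qed.

Definition log_phi_sum (m U : nat) s : R := \sum_(u < U) ln (phi m (s * u.+1%:R)).

Lemma log_phi_sumE m U s : 0 < s ->
  log_phi_sum m U s = log_sum U s - log_sum U (s * m.+1%:R).
Proof.
move=> s0; rewrite /log_sum -sumrB; apply: eq_bigr => u _.
by rewrite ln_phiE ?mulr_gt0 // opprK mulrA [m.+1%:R * s]mulrC.
Qed.

(** The limit of [s * log_phi_sum m U s]: in [log_phi_sumE] the first sum gives [pi ^ 2 / 6], and
    the one subtracted, taken at [s * (m + 1)], gives [1 / (m + 1)] of that. *)
Definition growth_const (m : nat) : R := pi ^+ 2 / 6 * (1 - m.+1%:R^-1).

Lemma log_phi_sum_asymptotic m (d : R) : 0 < d -> exists s1 M0 : R, [/\ 0 < s1, 0 < M0 &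
  forall (U : nat) s, 0 < s <= s1 -> M0 <= s * U%:R ->
    `|s * log_phi_sum m U s - growth_const m| <= d].
Proof.
move=> d0; have [s1 [M0 [s10 M00 H]]] := log_sum_asymptotic d0.
have m1 : 1 <= m.+1%:R :> R by rewrite ler1n.
have m0 : 0 < m.+1%:R :> R by rewrite ltr0n.
exists (s1 / m.+1%:R), M0; split => //; first by rewrite divr_gt0.
move=> U s /andP[s0]; rewrite ler_pdivlMr // => sm HU.
have s_le : s <= s * m.+1%:R by rewrite ler_peMr // ltW.
have lo1 := H U s; have lo2 := H U (s * m.+1%:R).
have sm0 : 0 < s * m.+1%:R by rewrite mulr_gt0.
have up1 := log_sum_le U s0; have up2 := log_sum_le U sm0.
have {}lo1 : pi ^+ 2 / 6 - d <= s * log_sum U s.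
  by apply: lo1 => //; rewrite s0 /= (le_trans s_le).
have {}lo2 : pi ^+ 2 / 6 - d <= s * m.+1%:R * log_sum U (s * m.+1%:R).
  by apply: lo2; rewrite ?sm0 //= (le_trans HU) // ler_wpM2r.
rewrite log_phi_sumE // /growth_const.
set A := log_sum U s in up1 lo1 *; set B := log_sum U _ in up2 lo2 *.
have i0 : 0 <= m.+1%:R^-1 :> R by rewrite invr_ge0 ltW.
have i1 : m.+1%:R^-1 <= 1 :> R by rewrite invf_le1.
have -> : s * (A - B) = s * A - m.+1%:R^-1 * (s * m.+1%:R * B) by field; rewrite gt_eqF.
move: (s * A) up1 lo1 (s * m.+1%:R * B) up2 lo2 => a up1 lo1 b up2 lo2.
have h1 := ler_wpM2l i0 up2; have h2 := ler_wpM2l i0 lo2.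
have h3 : m.+1%:R^-1 * d <= d by rewrite ler_piMl // ltW.
move: (m.+1%:R^-1) (pi ^+ 2 / 6) i0 i1 h1 h2 h3 up1 lo1 => i z i0 i1 h1 h2 h3 up1 lo1.
by rewrite ler_norml; apply/andP; split; lra.
Qed.

End LogSums.

Local Close Scope classical_set_scope.

(** * Rankin's bound and exponential tilting *)

Section Weights.
Variables (R : realType) (X : finType) (m : nat) (w : X -> nat).
Implicit Types (s : R) (g : {ffun X -> 'I_m.+1}).

Definition weight g : nat := (\sum_x g x * w x)%N.

Definition log_partition s : R := \sum_x ln (phi m (s * (w x)%:R)).

Lemma sum_expR_weight s :
  \sum_g expR (- (s * (weight g)%:R)) = expR (log_partition s).
Proof.
rewrite expR_sum (eq_bigr (fun x => phi m (s * (w x)%:R))) => [|x _]; last first.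
  by rewrite lnK // posrE phi_gt0.
rewrite bigA_distr_bigA /=; apply: eq_bigr => g _.
rewrite -expR_sum; congr expR; rewrite /weight natr_sum mulr_sumr -sumrN.
by apply: eq_bigr => x _; rewrite natrM mulrCA.
Qed.

(** Rankin's trick: each [g] in [G] contributes at least 1 to [exp (s * Q)] times the partition
    function. *)
Lemma card_weight_le s (Q : R) (G : {set {ffun X -> 'I_m.+1}}) : 0 <= s ->
  (forall g, g \in G -> (weight g)%:R <= Q) ->
  #|G|%:R <= expR (s * Q + log_partition s).
Proof.
move=> s0 GQ; rewrite expRD -sum_expR_weight mulr_sumr -sum1_card natr_sum.
rewrite big_mkcond; apply: ler_sum => g _; case: ifP => [/GQ le|_]; last first.
  by rewrite mulr_ge0 ?expR_ge0.
by rewrite mulr1n -expRD -[leLHS]expR0 ler_expR -mulrBr mulr_ge0 // subr_ge0.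
Qed.

(* Exponential tilting: the weights outside [Q1, Q] contribute little to the partition
   function at [s], as seen by comparison with [s'] above [Q] and with [s''] below [Q1]. *)
Lemma partition_le_window s s' s'' (Q1 Q : R) (G : {set {ffun X -> 'I_m.+1}}) :
  s' <= s <= s'' -> 0 <= s -> (forall g, g \notin G -> Q <= (weight g)%:R) ->
  expR (log_partition s) <= expR (- (s - s') * Q + log_partition s')
    + expR ((s'' - s) * Q1 + log_partition s'') + #|G|%:R * expR (- (s * Q1)).
Proof.
move=> /andP[s's ss''] s0 GQ.
rewrite 2!expRD -!sum_expR_weight !mulr_sumr -sum1_card natr_sum mulr_suml.
rewrite [X in _ <= _ + X]big_mkcond -!big_split; apply: ler_sum => g _ /=.
set n : R := (weight g)%:R.
have e1 := expR_gt0 (- (s - s') * Q); have e2 := expR_gt0 ((s'' - s) * Q1).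
have f1 := expR_gt0 (- (s' * n)); have f2 := expR_gt0 (- (s'' * n)).
have e3 := expR_gt0 (- (s * Q1)).
have p1 := mulr_gt0 e1 f1; have p2 := mulr_gt0 e2 f2.
rewrite mulr1n mul1r; have [gG|/GQ nQ] := boolP (g \in G); last first.
  have : expR (- (s * n)) <= expR (- (s - s') * Q) * expR (- (s' * n)).
    rewrite -expRD ler_expR.
    by have := @ler_wpM2l _ (s - s') _ _ _ nQ; rewrite subr_ge0 => /(_ s's); lra.
  by lra.
have [nQ1|nQ1] := leP n Q1.
  have : expR (- (s * n)) <= expR ((s'' - s) * Q1) * expR (- (s'' * n)).
    rewrite -expRD ler_expR.
    by have := @ler_wpM2l _ (s'' - s) _ _ _ nQ1; rewrite subr_ge0 => /(_ ss''); lra.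
  by lra.
have : expR (- (s * n)) <= expR (- (s * Q1)) by rewrite ler_expR lerN2 ler_wpM2l // ltW.
by lra.
Qed.

(* Abel summation. *)
Lemma sum_levels_le (psi : nat -> R) (kappa : R) (T : nat) :
  (forall u, 0 <= psi u) -> (forall u v, (u <= v)%N -> psi v <= psi u) ->
  (forall u, (u <= T)%N -> #|[set x | (0 < w x <= u)%N]|%:R <= kappa * u%:R) ->
  \sum_(x | (0 < w x <= T)%N) psi (w x) <= kappa * \sum_(u < T) psi u.+1.
Proof.
move=> psi0 psiN; set N := fun u => #|[set x | (0 < w x <= u)%N]|.
(* Strengthened for the induction on [T]: the slack of the level bound at [T], weighted by [psi T],
   is carried along. *)
suff S : (forall u, (u <= T)%N -> (N u)%:R <= kappa * u%:R) ->
    \sum_(x | (0 < w x <= T)%N) psi (w x) + psi T * (kappa * T%:R - (N T)%:R)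
     <= kappa * \sum_(u < T) psi u.+1.
  move=> H; apply: le_trans (S H); rewrite lerDl mulr_ge0 // subr_ge0.
  exact: H.
elim: T => [|T IHT] H.
  have N0 : N 0%N = 0%N.
    by apply/eqP; rewrite cards_eq0; apply/eqP/setP => x; rewrite !inE; lia.
  rewrite N0 big_ord0 big_pred0 ?mulr0 ?subrr ?mulr0 ?addr0 //.
  by move=> x; lia.
have {}IHT := IHT (fun u uT => H u (leqW uT)).
have HT := H T (leqnSn T).
have split_pred x : (0 < w x <= T.+1)%N = (0 < w x <= T)%N || (w x == T.+1) by lia.
have NS : N T.+1 = (N T + #|[set x | w x == T.+1]|)%N.
  rewrite /N -cardsUI [X in (_ + X)%N](_ : _ = 0)%N; last first.
    by apply/eqP; rewrite cards_eq0; apply/eqP/setP => x; rewrite !inE; lia.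
  by rewrite addn0; apply: eq_card => x; rewrite !inE split_pred.
have -> : \sum_(x | (0 < w x <= T.+1)%N) psi (w x) =
    \sum_(x | (0 < w x <= T)%N) psi (w x) + #|[set x | w x == T.+1]|%:R * psi T.+1.
  rewrite (bigID (fun x => w x == T.+1)) /= addrC; congr (_ + _).
    by apply: eq_bigl => x; lia.
  rewrite (eq_bigl (fun x => x \in [set x | w x == T.+1])) => [|x]; last by rewrite inE; lia.
  rewrite (eq_bigr (fun=> psi T.+1)) => [|x]; last by rewrite inE => /eqP->.
  by rewrite sumr_const mulr_natl.
rewrite big_ord_recr NS natrD -[in X in _ * (kappa * X - _)]natr1 mulrDr /=.
have h := psiN T T.+1 (leqnSn T).
have := ler_wpM2r (_ : 0 <= kappa * T%:R - (N T)%:R) h; rewrite subr_ge0 => /(_ HT).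
by lra.
Qed.

End Weights.

(** * Counting the long part *)

Section UpperWeight.
Variables (R : realType) (p m : nat) (p_pr : prime p).
Implicit Types (s : R) (B : {set 'F_p}).

(** The factor [#|B|.+1 - 2 * u] of [card_lam_leq] is at least [(1 - 1 / M) * #|B|], so the slope
    tends to 2 as [M] grows. The uncounted element [0] supplies the strict inequality required
    there. *)
Lemma card_lam_level B (M u : nat) : B != finset.set0 -> (5 * #|B| <= p)%N ->
  (1 < M)%N -> (2 * M * u <= #|B|)%N ->
  #|[set x : 'F_p | (0 < lam B x <= u)%N]|%:R <= (2 * M%:R / (M%:R - 1)) * u%:R :> R.
Proof.
move=> B0 Bp M1 MuB; have M1R : 0 < M%:R - 1 :> R by rewrite subr_gt0 ltr1n.
have [->|u0] := posnP u.
  rewrite mulr0 (_ : #|_| = 0)%N //; apply/eqP; rewrite cards_eq0.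
  by apply/eqP/setP => x; rewrite !inE; lia.
set N := #|_|.
have ltN : (N < #|[set x : 'F_p | lam B x <= u]|)%N.
  apply: proper_card; apply/properP; split.
    by apply/fintype.subsetP => x; rewrite !inE => /andP[].
  by exists 0; rewrite !inE lam0.
have u4 : (4 * u <= #|B|)%N by nia.
have := card_lam_leq p_pr u0 u4 Bp ltN => H.
have {H} H : (N * (M.-1 * #|B|) <= 2 * M * u * #|B|)%N.
  have E : (#|B|.+1 - 2 * u + 2 * u = #|B|.+1)%N by lia.
  have h1 : (M.-1 * #|B| <= M * (#|B|.+1 - 2 * u))%N.
    have : (M * (#|B|.+1 - 2 * u) + M * (2 * u) = M * #|B|.+1)%N by rewrite -mulnDr E.
    have : (M.-1 * #|B| + #|B| = M * #|B|)%N by rewrite -mulSnr prednK // ltnW.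
    by lia.
  apply: leq_trans (leq_mul (leqnn N) h1) _; rewrite mulnCA.
  by apply: leq_trans (leq_mul (leqnn M) H) _; rewrite !mulnA [(M * 2)%N]mulnC.
have b0 : (0 < #|B|)%N by rewrite card_gt0.
have {H} H : (N * M.-1 <= 2 * M * u)%N by rewrite -(leq_pmul2r b0) -mulnA.
rewrite mulrAC ler_pdivlMr //.
have -> : M%:R - 1 = M.-1%:R :> R by rewrite -subn1 natrB // ltnW.
by rewrite -!natrM ler_nat.
Qed.

(** Rankin's trick with weight [lam B]. Only [0] has weight 0, giving [ln (m + 1)]; weights up to
    [T] are compared with a partition sum by [sum_levels_le]; each element of larger weight
    contributes at most [m * exp (- (s * T))]. *)
Lemma card_growth_bounded_le (K M T : nat) B s : 0 < s -> (1 < K)%N -> (1 < M)%N ->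
  B != finset.set0 -> (5 * #|B| <= p)%N -> (2 * M * T <= #|B|)%N ->
  #|growth_bounded m K B|%:R <= expR (s * ((K + 9)%:R / (K%:R - 1) * p%:R) + ln m.+1%:R
     + 2 * M%:R / (M%:R - 1) * log_phi_sum m T s + p%:R * (m%:R * expR (- (s * T%:R)))).
Proof.
move=> s0 K1 M1 B0 Bp MTB; have K1R : 0 < K%:R - 1 :> R by rewrite subr_gt0 ltr1n.
apply: le_trans (@card_weight_le R _ m (lam B) s ((K + 9)%:R / (K%:R - 1) * p%:R) _ (ltW s0) _) _.
  move=> g; rewrite inE -/(weight (lam B) g) mulrAC ler_pdivlMr // mulrC => H.
  have -> : K%:R - 1 = K.-1%:R :> R by rewrite -subn1 natrB // ltnW.
  by rewrite -!natrM ler_nat.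
rewrite ler_expR -!addrA lerD2l /log_partition.
have pR : #|{: 'F_p}|%:R = p%:R :> R by rewrite card_Fp.
rewrite (bigID (fun x => lam B x == 0)%N) /=; apply: lerD.
  rewrite (eq_bigl (fun x => x \in [set (0 : 'F_p)])) => [|x].
    by rewrite big_set1 lam0 mulr0 phi0.
  rewrite inE; have [->|x0] := eqVneq x 0; first by rewrite lam0.
  apply/negbTE; rewrite -lt0n; apply: lam_gt0 => //.
  apply: contraTneq Bp => ->; rewrite cardsT card_Fp //.
  by have := prime_gt0 p_pr; lia.
rewrite (bigID (fun x => lam B x <= T)%N) /=; apply: lerD.
  rewrite (eq_bigl (fun x => (0 < lam B x <= T)%N)) => [|x]; last by rewrite lt0n.
  apply: (@sum_levels_le R _ (lam B) (fun u => ln (phi m (s * u%:R)))).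
  - by move=> u; apply: ln_phi_ge0.
  - move=> u v uv; rewrite ler_ln ?posrE ?phi_gt0 // phi_nincr // ler_wpM2l ?(ltW s0) //.
    by rewrite ler_nat.
  - by move=> u uT; apply: card_lam_level => //; apply: leq_trans MTB; rewrite leq_mul2l uT orbT.
rewrite -pR mulr_natl -sumr_const big_mkcond [leRHS]big_mkcond; apply: ler_sum => x _ /=.
case: ifP => [/andP[_ Tx]|_]; last by rewrite mulr_ge0 ?expR_ge0.
apply: le_trans (ln_phi_le _ _) _; first by rewrite mulr_ge0 // ltW.
by rewrite ler_wpM2l // ler_expR lerN2 ler_pM2l // ler_nat ltnW // ltnNge.
Qed.

End UpperWeight.

(** * Sequences of small weight *)

Definition residue_norm (p : nat) (x : 'F_p) : nat := minn x (p - x).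

Lemma big_count_mem (T : finType) (V : nmodType) (f : T -> V) (l : seq T) :
  \sum_(x <- l) f x = \sum_x f x *+ count_mem x l.
Proof.
elim: l => [|y l IHl]; first by rewrite big_nil big1.
rewrite big_cons IHl (bigD1 y) //= [RHS](bigD1 y) //= eqxx mulrnDr mulr1n addrA.
by congr (_ + _); apply: eq_bigr => x /negbTE xy; rewrite eq_sym xy add0n.
Qed.

Section LowerCount.
Variables (p m : nat) (p_pr : prime p).

(* Signed representatives of the sums of submultisets lie in an interval of length at
   most [p - 2], so some residue is missed. *)
Lemma incomplete_small_weight (g : {ffun 'F_p -> 'I_m.+1}) :
  (weight (@residue_norm p) g <= p - 2)%N -> incomplete (seq_mset (multiplicity_seq g)).
Proof.
have p1 := prime_gt1 p_pr.
move=> wg /seteqP[_ /(_ _ I)] all_sums.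
pose pos (x : 'F_p) := (x < p - x)%N.
pose neg := (\sum_(x | ~~ pos x) g x * (p - x))%N.
(* Signed sums range from [- neg] to at most [p - 2 - neg], so the residue just below [- neg] is
   missed. *)
have [B [sB _ BE]] := all_sums (- 1 - neg%:R).
have {}sB x : (B x <= g x)%N.
  by have /msubsetP/(_ x) := sB; rewrite mset_seqE count_multiplicity_seq.
pose u := (\sum_(x | pos x) B x * x)%N.
pose v := (\sum_(x | ~~ pos x) B x * (p - x))%N.
have le_v : (v <= neg)%N by apply: leq_sum => x _; rewrite leq_mul2r sB orbT.
have le_u : (u + neg <= p - 2)%N.
  apply: leq_trans wg; rewrite /weight (bigID pos) /=; apply: leq_add.
    apply: leq_sum => x; rewrite /pos /residue_norm => px.
    by rewrite (minn_idPl (ltnW px)) leq_mul2r sB orbT.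
  apply: leq_sum => x; rewrite /pos /residue_norm -leqNgt => px.
  by rewrite (minn_idPr px).
have xE (x : 'F_p) : x = (x : nat)%:R by rewrite natr_Zp.
have p0 : p%:R = 0 :> 'F_p by apply: pchar_Fp_0.
have sumE : \sum_(x <- B) x = u%:R - v%:R :> 'F_p.
  rewrite big_count_mem (bigID pos) /=; congr (_ + _).
    rewrite /u natr_sum; apply: eq_bigr => x _.
    by rewrite count_mem_mset natrM mulr_natl -xE.
  rewrite /v natr_sum -sumrN; apply: eq_bigr => x _.
  rewrite count_mem_mset natrM mulr_natl -mulNrn natrB ?p0 ?sub0r ?opprK -?xE //.
  by have := ltn_ord x; rewrite [X in (_ < X)%N](Fp_cast p_pr) => /ltnW.
have : ((u + (neg - v)).+1)%:R = 0 :> 'F_p.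
  have E : u%:R - v%:R = - 1 - neg%:R :> 'F_p by rewrite -sumE -BE.
  rewrite -natr1 natrD natrB //.
  transitivity (u%:R - v%:R + neg%:R + 1 : 'F_p); first by ring.
  by rewrite E; ring.
move/eqP; rewrite -(dvdn_pcharf (pchar_Fp p_pr)) => /dvdn_leq; lia.
Qed.

Lemma card_small_weight_le_N2 :
  (#|[set g : {ffun 'F_p -> 'I_m.+1} | weight (@residue_norm p) g <= p - 2]| <= N2 m p)%N.
Proof.
pose F := ([fset seq_mset (multiplicity_seq g) | g in
  [set g : {ffun 'F_p -> 'I_m.+1} | weight (@residue_norm p) g <= p - 2]%N])%fset.
have sF : (F `<=` fset_set (incomplete_seqs m p))%fset.
  apply/fsubsetP => _ /imfsetP[g /= gw ->]; rewrite in_fset_set; last exact: finite_incomplete_seqs.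
  rewrite inE /incomplete_seqs /=; split.
    by apply: incomplete_small_weight; rewrite inE in gw.
  apply/bigmax_leqP => x _; rewrite mset_seqE count_multiplicity_seq.
  by rewrite -ltnS.
apply: leq_trans (fsubset_leq_card sF); rewrite card_imfset /= ?cardE //.
move=> g g' /msetP E; apply/ffunP => x; apply: val_inj.
by have := E x; rewrite !mset_seqE !count_multiplicity_seq.
Qed.

(** As [p] is odd, each distance from 1 to [p./2] is attained by exactly two residues, [k] and
    [p - k]. *)
Lemma log_partition_residue_norm (R : realType) (s : R) : (2 < p)%N ->
  log_partition m (@residue_norm p) s = ln m.+1%:R + 2 * log_phi_sum m p./2 s.
Proof.
move=> p2; have podd : odd p by case: (even_prime p_pr) => // p2'; rewrite p2' in p2.
set U := p./2; have pE : (U + U).+1 = p by have := odd_double_half p; rewrite /U; lia.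
pose f (k : nat) : R := ln (phi m (s * (minn k (p - k))%:R)).
have -> : log_partition m (@residue_norm p) s = \sum_(0 <= k < (U + U).+1) f k.
  by rewrite pE -[in RHS](Fp_cast p_pr) big_mkord.
rewrite big_ltn // {1}/f min0n mulr0 phi0; congr (_ + _).
rewrite (@big_cat_nat _ _ _ U.+1) //=; last by lia.
have <- : \sum_(1 <= k < U.+1) f k = \sum_(U.+1 <= k < (U + U).+1) f k.
  rewrite [RHS]big_nat_rev /= -[X in _ = \sum_(X <= _ < _) _]add1n big_addn.
  rewrite subSn ?leq_addl // addnK big_nat_cond [RHS]big_nat_cond.
  apply: eq_bigr => k /andP[/andP[k1 kU] _]; rewrite /f minnC; congr (ln (phi m (s * _%:R))).
  by lia.
rewrite -mulr2n mulr_natl; congr (_ *+ _); rewrite big_add1 big_mkord.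
apply: eq_bigr => k _; rewrite /f (minn_idPl _) //.
by have := ltn_ord k; lia.
Qed.

End LowerCount.

(** * Asymptotics *)

Local Open Scope classical_set_scope.
Local Open Scope ring_scope.

Lemma near_sqrt_ge (R : realType) (A : R) : \forall p \near \oo, A <= Num.sqrt (p%:R : R).
Proof.
near=> p; apply: (le_trans (ler_norm A)).
rewrite -sqrtr_sqr ler_wsqrtr //; near: p; exact: nbhs_infty_ger.
Unshelve. all: by end_near. Qed.

Lemma near_root_ge (R : realType) (A : R) (k : nat) :
  \forall p \near \oo, forall y, (p < y.+1 ^ k)%N -> A <= y%:R.
Proof.
exists ((Num.truncn A).+1.+1 ^ k)%N => // p /= Ap y py.
apply/ltW/(lt_le_trans (truncnS_gt A)); rewrite ler_nat.
have := leq_ltn_trans Ap py; rewrite ltn_exp2r; last by case: (k) py => //; rewrite expn0; lia.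
by rewrite ltnS => /ltnW.
Qed.

Lemma exists_root (k p : nat) : (0 < k)%N -> exists y, (y ^ k <= p < y.+1 ^ k)%N.
Proof.
move=> k0; have [|n|y yp ymax] := @ex_maxnP (fun y => y ^ k <= p)%N p.
- by exists 0%N; rewrite exp0n.
- move=> np; have [n0|n1] := leqP n 1; first by case: n n0 np => [|[|]] //; rewrite exp1n.
  by apply: leq_trans np; rewrite -{1}(expn1 n) leq_pexp2l // ltnW.
- exists y; rewrite yp ltnNge; apply/negP => /ymax; lia.
Qed.

Lemma expR_le_quarter (R : realType) (a b : R) : a + 3 <= b -> expR a <= expR b / 4.
Proof.
move=> ab; rewrite ler_pdivlMr // -[b](subrKC a) expRD ler_pM2l ?expR_gt0 //.
by have := expR_ge1Dx (b - a); lra.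
Qed.

Lemma expR_decay (R : realType) (c : R) : 0 < c -> exists2 A : R, 0 < A &
  forall (y : nat) (z : R), (0 < y)%N -> c * y%:R <= z -> y%:R ^+ 6 * expR (- z) <= A.
Proof.
move=> c0; exists ((6 / c) ^+ 6); first by rewrite exprn_gt0 // divr_gt0.
move=> y z y0 cz; have yR : 0 < y%:R :> R by rewrite ltr0n.
have E : expR (- z) = expR (- (z / 6)) ^+ 6.
  by rewrite -expRM_natl; congr expR; field.
rewrite E -exprMn lerXn2r ?nnegrE ?mulr_ge0 ?expR_ge0 ?invr_ge0 ?(ltW c0) //.
rewrite expRN ler_pdivrMr ?expR_gt0 // mulrAC ler_pdivlMr //.
by have := expR_ge1Dx (z / 6); lra.
Qed.

Section Asymptotics.
Variables (R : realType) (m : nat) (m_gt0 : (0 < m)%N).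

(** The saddle point: [sigma / sqrt p] minimizes [s * p + 2 * growth_const / s], with minimum
    [2 * sigma * sqrt p], the exponent of the theorem by [double_sigma]. *)
Definition sigma : R := Num.sqrt (2 * growth_const R m).

Lemma growth_const_gt0 : 0 < growth_const R m.
Proof.
rewrite mulr_gt0 ?divr_gt0 ?exprn_gt0 ?pi_gt0 // subr_gt0 invf_lt1 ?ltr0n //.
by rewrite ltr1n.
Qed.

Lemma sigma_gt0 : 0 < sigma.
Proof. by rewrite sqrtr_gt0 mulr_gt0 // growth_const_gt0. Qed.

Lemma sigma_sqr : sigma ^+ 2 = 2 * growth_const R m.
Proof. by rewrite sqr_sqrtr // mulr_ge0 // ltW // growth_const_gt0. Qed.

Lemma double_sigma : Num.sqrt ((1 - m.+1%:R^-1) * (4 / 3)) * pi = 2 * sigma :> R.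
Proof.
have s0 := sigma_gt0; have g0 := growth_const_gt0.
have pi0 := @pi_gt0 R.
apply/eqP; rewrite -(eqrXn2 (_ : (0 < 2)%N)) ?mulr_ge0 ?sqrtr_ge0 ?(ltW s0) ?(ltW pi0) //.
rewrite !exprMn sigma_sqr sqr_sqrtr; first by apply/eqP; rewrite /growth_const; field.
rewrite mulr_ge0 // subr_ge0 invf_le1 ?ler1n //.
Qed.

(** Here [r] stands for [1 / sqrt p], and [x] displaces the saddle point: the upper bound takes
    [x = 1], the lower bound compares several values. *)
Lemma log_phi_sum_near (d : R) : 0 < d -> exists r0 M0 : R, [/\ 0 < r0, 0 < M0 &
  forall (U : nat) (x r : R), 1 <= x <= 4 -> 0 < r -> r * r0 <= 1 -> M0 <= r * U%:R ->
    `|2 * log_phi_sum m U (x * sigma * r) - sigma / x / r| <= d / r].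
Proof.
move=> d0; have sg0 := sigma_gt0.
have [|s1 [M0 [s10 M00 H]]] := @log_phi_sum_asymptotic R m (d * sigma / 2).
  by rewrite !divr_gt0 // mulr_gt0.
exists (4 * sigma / s1), (M0 / sigma); split; rewrite ?divr_gt0 ?mulr_gt0 //.
move=> U x r /andP[x1 x4] r0 rs rU; have x0 : 0 < x by lra.
have S0 : 0 < x * sigma * r by rewrite !mulr_gt0.
have := H U (x * sigma * r); rewrite S0 /=.
have -> : x * sigma * r <= s1.
  rewrite mulrA ler_pdivrMr // mul1r in rs; apply: le_trans rs.
  by rewrite [leRHS]mulrC ler_wpM2r ?(ltW r0) // ler_wpM2r ?(ltW sg0).
move=> /(_ isT); have -> : M0 <= x * sigma * r * U%:R.
  rewrite ler_pdivrMr // in rU; apply: le_trans rU _.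
  rewrite (_ : x * sigma * r * _ = x * (r * U%:R * sigma)); last by ring.
  by rewrite ler_peMl // !mulr_ge0 // ltW.
move=> /(_ isT) H2.
have -> : 2 * log_phi_sum m U (x * sigma * r) - sigma / x / r =
    2 / (x * sigma * r) * (x * sigma * r * log_phi_sum m U (x * sigma * r) - growth_const R m).
  have -> : growth_const R m = sigma ^+ 2 / 2 by rewrite sigma_sqr; field.
  by field; rewrite !gt_eqF.
rewrite normrM gtr0_norm ?divr_gt0 //.
apply: (@le_trans _ _ (2 / (x * sigma * r) * (d * sigma / 2))).
  by rewrite ler_wpM2l ?divr_ge0 ?(ltW S0).
have -> : 2 / (x * sigma * r) * (d * sigma / 2) = x^-1 * (d / r) by field; rewrite !gt_eqF.
by rewrite ler_piMl ?divr_ge0 ?(ltW d0) ?(ltW r0) // invf_le1.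
Qed.

Lemma N2_gt0 p : prime p -> (0 < N2 m p)%N.
Proof.
move=> p_pr; apply: leq_trans (card_small_weight_le_N2 m p_pr).
apply/card_gt0P; exists [ffun=> ord0]; rewrite inE /weight big1 // => x _.
by rewrite ffunE.
Qed.


Lemma log_partition_near (d : R) : 0 < d -> \forall p \near \oo, prime p ->
  forall x q : R, 1 <= x <= 4 -> q = Num.sqrt p%:R ->
  sigma / x * q - d * q <= log_partition m (@residue_norm p) (x * sigma / q)
  <= sigma / x * q + d * q.
Proof.
move=> d0; have d2 : 0 < d / 2 by rewrite divr_gt0.
have [r0 [M0 [r00 M00 H]]] := log_phi_sum_near d2.
near=> p; move=> p_pr x q x14 qE.
have p2 : (2 < p)%N by near: p; exact: nbhs_infty_gt.
have q1 : 1 <= q by rewrite qE; near: p; exact: near_sqrt_ge.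
have q0 : 0 < q by lra.
have qM : 4 * M0 <= q by rewrite qE; near: p; exact: near_sqrt_ge.
have qr : r0 <= q by rewrite qE; near: p; exact: near_sqrt_ge.
have qm : ln m.+1%:R / (d / 2) <= q by rewrite qE; near: p; exact: near_sqrt_ge.
have qq : q ^+ 2 = p%:R by rewrite qE sqr_sqrtr.
rewrite log_partition_residue_norm //.
have lm0 : 0 <= ln (m.+1%:R : R) by rewrite ln_ge0 // ler1n.
rewrite ler_pdivrMr // in qm.
have := H p./2 x q^-1 x14; rewrite invr_gt0 q0 invrK => /(_ isT).
have -> : q^-1 * r0 <= 1 by rewrite mulrC ler_pdivrMr // mul1r.
have -> : M0 <= q^-1 * (p./2)%:R.
  rewrite mulrC ler_pdivlMr //.
  have : p%:R <= 4 * (p./2)%:R :> R.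
    rewrite -natrM ler_nat; have := odd_double_half p.
    by clear -p2; lia.
  by rewrite -qq expr2; have := ler_wpM2r (ltW q0) qM; lra.
by move=> /(_ isT isT); rewrite ler_norml => /andP[h1 h2]; apply/andP; split; lra.
Unshelve. all: by end_near. Qed.

(** Tilt at [x * sigma / q] with [x] slightly above 1 and compare, by [partition_le_window], with
    [sigma / q] and [x ^ 2 * sigma / q]. *)
Lemma ln_N2_ge (d : R) : 0 < d -> \forall p \near \oo, prime p ->
  (2 * sigma - d) * Num.sqrt p%:R <= ln (N2 m p)%:R.
Proof.
move=> d0; have sg0 := sigma_gt0.
pose al := Num.min 1 (d / (16 * sigma)); pose x := 1 + al.
have al0 : 0 < al by rewrite lt_min ltr01 divr_gt0 // mulr_gt0.
have al1 : al <= 1 by rewrite ge_min lexx.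
have ald : 16 * sigma * al <= d.
  by rewrite mulrC -ler_pdivlMr ?mulr_gt0 // ge_min lexx orbT.
have x1 : 1 < x by rewrite ltrDl.
have x0 : 0 < x by lra.
have x2 : x <= 2 by rewrite /x; lra.
(* Up to errors of order [dl * q], both error exponents will lie at least [gam * sigma * q] below
   the exponent [E0] of the main term. *)
pose gam := (x - 1) ^+ 2 / x ^+ 3.
have gam0 : 0 < gam by rewrite divr_gt0 ?exprn_gt0 // subr_gt0.
pose dl := Num.min (sigma * gam / 8) (d / 8).
have dl0 : 0 < dl.
  by rewrite lt_min; apply/andP; split; rewrite divr_gt0 // mulr_gt0.
have dl1 : dl <= sigma * gam / 8 by rewrite ge_min lexx.
have dl2 : dl <= d / 8 by rewrite ge_min lexx orbT.
near=> p; move=> p_pr.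
have p2 : (2 < p)%N by near: p; exact: nbhs_infty_gt.
have : prime p -> forall x q : R, 1 <= x <= 4 -> q = Num.sqrt p%:R ->
  sigma / x * q - dl * q <= log_partition m (@residue_norm p) (x * sigma / q)
  <= sigma / x * q + dl * q by near: p; exact: log_partition_near.
move=> /(_ p_pr) LZ'; pose q : R := Num.sqrt p%:R.
have {LZ'} LZ x0 x14 := LZ' x0 q x14 erefl.
have q1 : 1 <= q by rewrite /q; near: p; exact: near_sqrt_ge.
have q0 : 0 < q by lra.
have qs : sigma / dl <= q by rewrite /q; near: p; exact: near_sqrt_ge.
have qg : 6 / (sigma * gam) <= q by rewrite /q; near: p; exact: near_sqrt_ge.
have qd : 8 / d <= q by rewrite /q; near: p; exact: near_sqrt_ge.
have sgam0 : 0 < sigma * gam by rewrite mulr_gt0.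
rewrite ler_pdivrMr // in qs; rewrite ler_pdivrMr // in qg.
rewrite ler_pdivrMr // in qd.
have qq : q ^+ 2 = p%:R by rewrite sqr_sqrtr.
have xx4 : x ^+ 2 <= 4 by rewrite expr2; nra.
have xx1 : 1 <= x ^+ 2 by rewrite expr2; nra.
have [x14 xx14] : 1 <= x <= 4 /\ 1 <= x ^+ 2 <= 4 by split; apply/andP; split => //; lra.
have l14 : 1 <= (1 : R) <= 4 by apply/andP; split; lra.
have /andP[_ L1] := LZ 1 l14; have /andP[L0 _] := LZ x x14; have /andP[_ L2] := LZ _ xx14.
rewrite mul1r in L1.
pose G := [set g : {ffun 'F_p -> 'I_m.+1} | (weight (@residue_norm p) g <= p - 2)%N]%SET.
have GQ (g : {ffun 'F_p -> 'I_m.+1}) : g \notin G -> q ^+ 2 - 1 <= (weight (@residue_norm p) g)%:R.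
  rewrite inE -ltnNge qq lerBlDr natr1 ler_nat.
  by move: (weight _ _) => w; clear -p2; lia.
have GN : (#|G| <= N2 m p)%N by apply: card_small_weight_le_N2.
have ss : sigma / q <= x * sigma / q <= x ^+ 2 * sigma / q.
  apply/andP; split; rewrite ler_pM2r ?invr_gt0 //; first by rewrite ler_peMl // ltW.
  by rewrite ler_pM2r // expr2 ler_peMr // ltW.
have s0 : 0 <= x * sigma / q by rewrite divr_ge0 ?mulr_ge0 // ltW.
(* Under the tilt the typical weight is about [q ^ 2 / x ^ 2], inside the window from
   [q ^ 2 / x ^ 4] to [q ^ 2 - 1]. *)
have := partition_le_window (q ^+ 2 / x ^+ 4) ss s0 GQ.
set E0 := log_partition _ _ (x * sigma / q) in L0 *.
set E1 := log_partition _ _ (sigma / q) in L1 *.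
set E2 := log_partition _ _ (x ^+ 2 * sigma / q) in L2 *.
have -> : - (x * sigma / q - sigma / q) * (q ^+ 2 - 1) =
    - ((x - 1) * sigma * q) + (x - 1) * sigma / q by field; rewrite gt_eqF.
have -> : (x ^+ 2 * sigma / q - x * sigma / q) * (q ^+ 2 / x ^+ 4) =
    (x - 1) / x ^+ 3 * sigma * q by field; rewrite !gt_eqF.
have -> : x * sigma / q * (q ^+ 2 / x ^+ 4) = x ^- 3 * sigma * q by field; rewrite !gt_eqF.
have small : (x - 1) * sigma / q <= dl * q.
  rewrite ler_pdivrMr //; apply: (@le_trans _ _ sigma).
    by rewrite ler_piMl ?(ltW sg0) //; lra.
  by rewrite mulrC in qs; apply: le_trans qs _; rewrite ler_peMr ?mulr_ge0 // ltW.
have g1 : (1 / x - (2 - x)) >= gam.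
  rewrite (_ : 1 / x - _ = (x - 1) ^+ 2 / x); last by field; rewrite gt_eqF.
  rewrite /gam ler_wpM2l ?sqr_ge0 // lef_pV2 ?posrE ?exprn_gt0 //.
  by rewrite exprS ler_peMr // ltW.
have g2 : 1 / x - x ^- 2 - (x - 1) / x ^+ 3 = gam by rewrite /gam; field; rewrite gt_eqF.
have gq : 6 <= sigma * gam * q by rewrite mulrC.
have dq : 3 * (dl * q) + 3 <= sigma * gam * q.
  have := ler_wpM2r (ltW q0) dl1; lra.
have T1 : expR (- ((x - 1) * sigma * q) + (x - 1) * sigma / q + E1) <= expR E0 / 4.
  apply: expR_le_quarter.
  have := ler_wpM2l (mulr_ge0 (ltW sg0) (ltW q0)) g1.
  move: L1 L0; rewrite mul1r divr1; lra.
have T2 : expR ((x - 1) / x ^+ 3 * sigma * q + E2) <= expR E0 / 4.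
  apply: expR_le_quarter.
  have : sigma * q * (1 / x - x ^- 2 - (x - 1) / x ^+ 3) = sigma * q * gam by rewrite g2.
  move: L2 L0; lra.
move=> /le_trans/(_ (lerD (lerD T1 T2) (lexx _))) {T1 T2} H.
have {}H : expR E0 / 2 <= #|G|%:R * expR (- (x ^- 3 * sigma * q)).
  by move: (expR E0) (_ * expR _) H; clear => e g; lra.
have {}H : expR (E0 + x ^- 3 * sigma * q - 1) <= (N2 m p)%:R.
  have : #|G|%:R <= (N2 m p)%:R :> R by rewrite ler_nat.
  apply: le_trans; move: (x ^- 3 * sigma * q) H => a H.
  have {}H : expR E0 / 2 * expR a <= #|G|%:R.
    by rewrite -(ler_pM2r (expR_gt0 (- a))) -[leLHS]mulrA -expRD subrr expR0 mulr1.
  apply: le_trans H; rewrite !expRD [leRHS]mulrAC ler_pM2l ?mulr_gt0 ?expR_gt0 //.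
  by rewrite expRN lef_pV2 ?posrE ?expR_gt0 //; have := expR_ge1Dx (1 : R); lra.
rewrite -ler_expR lnK ?posrE ?ltr0n ?N2_gt0 //; apply: le_trans H; rewrite ler_expR -/q.
have i1 : 1 / x >= 1 - al.
  by rewrite ler_pdivlMr // /x; nra.
have i3 : x ^- 3 >= 1 - 3 * al.
  rewrite -[leRHS]mul1r ler_pdivlMr ?exprn_gt0 // /x.
  rewrite (_ : _ * _ = 1 - (6 * al ^+ 2 + 8 * al ^+ 3 + 3 * al ^+ 4)); last by ring.
  by rewrite lerBlDr lerDl !addr_ge0 // mulr_ge0 // exprn_ge0 // ltW.
have h1 := ler_wpM2l (mulr_ge0 (ltW sg0) (ltW q0)) i1.
have h3 := ler_wpM2l (mulr_ge0 (ltW sg0) (ltW q0)) i3.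
have h4 := ler_wpM2r (ltW q0) ald.
have h5 := ler_wpM2r (ltW q0) dl2.
by lra.
Unshelve. all: by end_near. Qed.

(** The scales: [y] is the integer tenth root of [p] and [t = y ^ 3]. Then [B] has at least [y ^ 6]
    elements, well above [sqrt p], so [T] can be of order [y ^ 6]; the short part has [O(y ^ 3)]
    terms and costs [O(y ^ 4)] in the exponent, as [p + 1 <= (y + 1) ^ 10 <= exp (10 * y)]. *)
Lemma ln_N2_le_at (p K M y T : nat) (s : R) : prime p -> (24 < p)%N -> (0 < y)%N ->
  (y ^ 10 <= p < y.+1 ^ 10)%N -> (40 <= K)%N -> (1 < M)%N -> 0 < s ->
  T = (y ^ 6 %/ (2 * M))%N ->
  ln (N2 m p)%:R <= 1 + (110 * m * K ^ 2 * y ^ 4)%:R +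
    (s * ((K + 9)%:R / (K%:R - 1) * p%:R) + ln m.+1%:R
     + 2 * M%:R / (M%:R - 1) * log_phi_sum m T s + p%:R * (m%:R * expR (- (s * T%:R)))).
Proof.
move=> p_pr p24 y0 /andP[yp py] K40 M1 s0 TE; set lnW := _ + _ + _ + _.
have K1 : (1 < K)%N by lia.
have lnW0 : 0 <= lnW.
  have K0 : 0 <= (K%:R - 1)^-1 :> R by rewrite invr_ge0 subr_ge0 ler1n ltnW.
  have M0 : 0 <= (M%:R - 1)^-1 :> R by rewrite invr_ge0 subr_ge0 ler1n ltnW.
  have Psi0 : 0 <= log_phi_sum m T s by apply: sumr_ge0 => u _; apply: ln_phi_ge0.
  have lm0 : 0 <= ln (m.+1%:R : R) by rewrite ln_ge0 // ler1n.
  by rewrite !addr_ge0 // !mulr_ge0 ?expR_ge0 // ltW.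
pose t := (y ^ 3)%N; pose h := (m * (4 * t).+1 + 5 * t)%N.
have t0 : (0 < t)%N by rewrite expn_gt0 y0.
have hle : (h <= 10 * m * t)%N.
  rewrite /h; have := leq_pmulr m t0; have := leq_pmull t m_gt0.
  by move: (t) => u; clear; lia.
have WB (B : {set 'F_p}) : (t ^ 2 <= #|B|)%N -> (5 * #|B| <= p)%N ->
    (#|growth_bounded m K B| <= Num.truncn (expR lnW))%N.
  rewrite /t -expnM => tB pB; rewrite truncn_ge_nat ?expR_ge0 //.
  apply: card_growth_bounded_le => //.
    by rewrite -card_gt0 (leq_trans _ tB) // expn_gt0 y0.
  by rewrite (leq_trans _ tB) // TE mulnC leq_trunc_div.
have := N2_upper p_pr K40 p24 t0 (leqnn h) WB => le_N2.
have E0 : 1 <= expR lnW by rewrite -expR0 ler_expR.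
have N20 := N2_gt0 p_pr.
rewrite -ler_expR lnK ?posrE ?ltr0n //.
have Wle : (Num.truncn (expR lnW))%:R <= expR lnW by rewrite truncn_le expR_ge0.
pose E := (K * (K * h)).+1.
have N2R : (N2 m p)%:R <= 2 * (p.+1 ^ E)%:R * expR lnW :> R.
  apply: (@le_trans _ _ ((p.+1 ^ (K * (K * h)))%:R + (p * p.+1 ^ (K * h))%:R * expR lnW)).
    apply: le_trans (_ : (p.+1 ^ (K * (K * h)) +
      p * p.+1 ^ (K * h) * Num.truncn (expR lnW))%N%:R <= _).
      by rewrite ler_nat.
    by rewrite natrD lerD2l natrM ler_wpM2l.
  have h1 : (p.+1 ^ (K * (K * h)))%:R <= (p.+1 ^ E)%:R * expR lnW :> R.
    by rewrite -[leLHS]mulr1 ler_pM // ler_nat leq_pexp2l.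
  have h2 : (p * p.+1 ^ (K * h))%:R * expR lnW <= (p.+1 ^ E)%:R * expR lnW.
    rewrite ler_wpM2r ?expR_ge0 // ler_nat /E expnS leq_mul //.
    by rewrite leq_pexp2l // leq_pmull //; lia.
  by lra.
apply: le_trans N2R _; rewrite [leRHS]expRD ler_wpM2r ?expR_ge0 // [leRHS]expRD ler_pM //.
  by have := expR_ge1Dx (1 : R); lra.
apply: (@le_trans _ _ (expR ((y * (10 * E))%:R))).
  apply: (@le_trans _ _ ((y.+1 ^ 10) ^ E)%N%:R); first by rewrite ler_nat leq_exp2r.
  rewrite natrM expRM_natr !natrX -exprM lerXn2r ?nnegrE ?expR_ge0 //.
  by rewrite -nat1r expR_ge1Dx.
rewrite ler_expR ler_nat.
have h1 : (K * (K * h) <= K ^ 2 * (10 * m * t))%N by rewrite mulnA mulnn leq_mul2l hle orbT.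
have h2 : (0 < m * K ^ 2 * t)%N by rewrite 2!muln_gt0 m_gt0 t0 expn_gt0 (ltnW K1).
have h3 : (E <= 11 * (m * K ^ 2 * t))%N.
  by rewrite /E; move: (K * (K * h))%N h1 h2 => a; move: (K ^ 2)%N => b; clear; lia.
have h4 : (y ^ 4 = y * t)%N by rewrite /t -expnS.
have := leq_mul (leqnn (10 * y)) h3; rewrite h4; move: (E) (K ^ 2)%N => e b; clear; lia.
Qed.

Lemma ln_N2_le (d : R) : 0 < d -> \forall p \near \oo, prime p ->
  ln (N2 m p)%:R <= (2 * sigma + d) * Num.sqrt p%:R.
Proof.
move=> d0; have sg0 := sigma_gt0.
pose dl := Num.min 1 (d / 16).
have dl0 : 0 < dl by rewrite lt_min ltr01 divr_gt0.
have dl1 : dl <= 1 by rewrite ge_min lexx.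
have dl2 : dl <= d / 16 by rewrite ge_min lexx orbT.
(* [M] brings [2 * M / (M - 1)] close to 2, and [K] below brings [(K + 9) / (K - 1)] close to 1. *)
pose M := (Num.truncn (16 * (sigma + 1) / d)).+2.
have M1 : (1 < M)%N by [].
have MR : 16 * (sigma + 1) <= d * (M%:R - 1).
  rewrite [leRHS]mulrC -ler_pdivrMr //; apply: ltW; apply: lt_le_trans (truncnS_gt _) _.
  by rewrite lerBrDr natr1.
pose K := (40 + Num.truncn (80 * sigma / d)).+1.
have K40 : (40 <= K)%N by rewrite /K ltnS leq_addr.
have KR : 80 * sigma <= d * (K%:R - 1).
  rewrite [leRHS]mulrC -ler_pdivrMr //; apply: ltW; apply: lt_le_trans (truncnS_gt _) _.
  by rewrite lerBrDr natr1 ler_nat /K; move: (Num.truncn _) => k; clear; lia.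
have K1R : 0 < K%:R - 1 :> R by rewrite subr_gt0 ltr1n ltnS.
have M1R : 0 < M%:R - 1 :> R by rewrite subr_gt0 ltr1n.
have [r0 [M0 [r00 M00 HL]]] := log_phi_sum_near dl0.
(* Chosen so that [c1 * y <= s * T]: with [s = sigma / q], use [T >= y ^ 6 / (4 * M)] and
   [q <= 32 * y ^ 5]. *)
pose c1 := sigma / (128 * M%:R).
have c10 : 0 < c1 by rewrite divr_gt0 // mulr_gt0 // ltr0n.
have [A A0 HA] := expR_decay c10.
near=> p; move=> p_pr.
have p24 : (24 < p)%N by near: p; exact: nbhs_infty_gt.
pose q : R := Num.sqrt p%:R.
have q1 : 1 <= q by rewrite /q; near: p; exact: near_sqrt_ge.
have q0 : 0 < q by lra.
have qr : r0 <= q by rewrite /q; near: p; exact: near_sqrt_ge.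
have qm : (1 + ln m.+1%:R) / (d / 8) <= q by rewrite /q; near: p; exact: near_sqrt_ge.
rewrite ler_pdivrMr ?divr_gt0 // in qm.
have qq : q ^+ 2 = p%:R by rewrite sqr_sqrtr.
have [y /andP[yp py]] := @exists_root 10 p isT.
have root B : (forall y, (p < y.+1 ^ 10)%N -> B <= y%:R :> R) -> B <= y%:R by apply.
have y1 : 1 <= y%:R :> R by apply: root; near: p; exact: near_root_ge.
have yM : (4 * M)%:R <= y%:R :> R by apply: root; near: p; exact: near_root_ge.
have yM0 : 128 * M%:R * M0 <= y%:R by apply: root; near: p; exact: near_root_ge.
have yK : 880 * (m * K ^ 2)%:R / d <= y%:R by apply: root; near: p; exact: near_root_ge.
have yA : 256 * m%:R * A / d <= y%:R by apply: root; near: p; exact: near_root_ge.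
rewrite ler_pdivrMr // in yK; rewrite ler_pdivrMr // in yA.
have y0 : 0 < y%:R :> R by lra.
have y0N : (0 < y)%N by rewrite -(ltr0n R).
have q_le : q <= 32 * y%:R ^+ 5.
  have -> : 32 * y%:R ^+ 5 = (2 * y%:R) ^+ 5 :> R by ring.
  rewrite -ler_sqr ?nnegrE ?exprn_ge0 ?mulr_ge0 ?(ltW q0) // qq -exprM -natrM -natrX ler_nat.
  by apply: ltnW; apply: leq_trans py _; rewrite leq_exp2r // mul2n -addnn -addn1 leq_add2l.
have q_ge : y%:R ^+ 5 <= q.
  by rewrite -ler_sqr ?nnegrE ?exprn_ge0 ?(ltW q0) // qq -exprM -natrX ler_nat.
pose T := (y ^ 6 %/ (2 * M))%N.
have TN : (y ^ 6 <= 4 * M * T)%N.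
  have M4 : (4 * M <= y)%N by rewrite -(ler_nat R).
  have y6 : (y <= y ^ 6)%N by rewrite -{1}(expn1 y) leq_pexp2l.
  have := divn_eq (y ^ 6) (2 * M); rewrite -/T.
  have := ltn_pmod (y ^ 6) (isT : (0 < 2 * M)%N).
  move: (y ^ 6 %% (2 * M))%N M4 y6; move: (y ^ 6)%N (M) (T) => b M' T' a.
  by clear; lia.
have TR : y%:R ^+ 6 <= 4 * M%:R * T%:R :> R by rewrite -natrX -!natrM ler_nat.
have M00' : 0 < M%:R :> R by rewrite ltr0n.
have T1 : M0 <= q^-1 * T%:R.
  rewrite mulrC ler_pdivlMr // -(ler_pM2l (_ : 0 < 4 * M%:R :> R)) ?mulr_gt0 //.
  apply: le_trans TR; apply: (@le_trans _ _ (4 * M%:R * M0 * (32 * y%:R ^+ 5))).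
    by rewrite [leLHS]mulrA ler_pM2l // !mulr_gt0.
  have := ler_wpM2r (exprn_ge0 5 (ltW y0)) yM0; rewrite -exprS; apply: le_trans.
  by rewrite (_ : 4 * _ * _ * _ = 128 * M%:R * M0 * y%:R ^+ 5) //; ring.
pose s := 1 * sigma * q^-1.
have s0 : 0 < s by rewrite /s mul1r divr_gt0.
have T2 : c1 * y%:R <= s * T%:R.
  rewrite /c1 /s mul1r -!mulrA ler_pM2l // mulrC ler_pdivrMr ?mulr_gt0 //.
  rewrite -(ler_pM2l q0).
  rewrite (_ : q * (q^-1 * _ * _) = 32 * (4 * M%:R * T%:R)); last by field; rewrite gt_eqF.
  apply: (@le_trans _ _ (32 * y%:R ^+ 5 * y%:R)); first by rewrite ler_pM2r.
  by rewrite -mulrA -exprSr ler_pM2l.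
have P1 := HA y _ y0N T2.
(* One factor [q] of [p] is kept and the other is at most [32 * y ^ 5]; since
   [y ^ 6 * exp (- (s * T))] is bounded, a factor [1 / y] is left to beat the constants. *)
have tail : p%:R * (m%:R * expR (- (s * T%:R))) <= d / 8 * q.
  have e0 := expR_gt0 (- (s * T%:R)).
  apply: (@le_trans _ _ (q * (32 * m%:R * (y%:R ^+ 5 * expR (- (s * T%:R)))))).
    rewrite -qq expr2 -mulrA ler_pM2l //.
    have := ler_wpM2r (mulr_ge0 (ler0n R m) (ltW e0)) q_le; lra.
  rewrite mulrC ler_pM2r //.
  rewrite -(ler_pM2r y0); move: P1; rewrite exprS; move: (expR _) e0 => e e0 P1.
  by have := ler_wpM2l (mulr_ge0 (ler0n R 32) (ler0n R m)) P1; lra.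
have := HL T 1 q^-1; rewrite lexx ler1n invr_gt0 q0 invrK -/s => /(_ isT isT).
have -> : q^-1 * r0 <= 1 by rewrite mulrC ler_pdivrMr // mul1r.
move=> /(_ isT T1); rewrite divr1 ler_norml => /andP[_ L2].
have := @ln_N2_le_at p K M y T s p_pr p24 y0N _ K40 M1 s0 erefl.
rewrite yp py => /(_ isT)/le_trans; apply.
have X1 : s * ((K + 9)%:R / (K%:R - 1) * p%:R) <= (sigma + d / 8) * q.
  rewrite /s mul1r natrD -qq.
  have -> : sigma / q * ((K%:R + 9) / (K%:R - 1) * q ^+ 2) =
      (sigma + 10 * sigma / (K%:R - 1)) * q by field; rewrite !gt_eqF.
  by rewrite ler_pM2r // lerD2l ler_pdivrMr //; lra.
have X3 : 2 * M%:R / (M%:R - 1) * log_phi_sum m T s <= (sigma + d / 8) * q.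
  have -> : 2 * M%:R / (M%:R - 1) * log_phi_sum m T s =
     (1 + (M%:R - 1)^-1) * (2 * log_phi_sum m T s) by field; rewrite gt_eqF.
  apply: (@le_trans _ _ ((1 + (M%:R - 1)^-1) * ((sigma + dl) * q))).
    by rewrite ler_wpM2l ?addr_ge0 ?invr_ge0 ?(ltW M1R) //; lra.
  rewrite mulrA ler_pM2r // mulrDl mul1r.
  have : (M%:R - 1)^-1 * (sigma + dl) <= d / 16.
    by rewrite mulrC ler_pdivrMr //; lra.
  by lra.
have X0 : (110 * m * K ^ 2 * y ^ 4)%:R <= d / 8 * q.
  rewrite -(mulnA 110) natrM natrX [(110 * _)%:R]natrM.
  have h1 := ler_wpM2r (exprn_ge0 4 (ltW y0)) yK.
  have h2 := ler_wpM2r (ltW d0) q_ge; rewrite exprS in h2.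
  move: (m * K ^ 2)%:R (y%:R ^+ 4) h1 h2 => a b h1 h2.
  by lra.
apply: le_trans (lerD (lerD (lexx 1) X0) (lerD (lerD (lerD X1 (lexx _)) X3) tail)) _.
by have := mulr_gt0 q0 d0; rewrite -/q; lra.
Unshelve. all: by end_near. Qed.

End Asymptotics.

Unset Implicit Arguments.

Theorem theorem5p4 (R : realType) (m : nat) (m_gt0 : (0 < m)%N) :
  exists eps : nat -> R,
    eps n @[n --> \oo] --> (0 : R) /\
    forall p : nat, prime p ->
      (N2 m p)%:R =
        expR ((Num.sqrt ((1 - (m.+1%:R)^-1) * (4 / 3)) * pi + eps p)
              * Num.sqrt (p%:R : R)).
Proof.
(* Solve the equation for [eps] at primes; the value 0 elsewhere lets the limit run over all natural
   numbers. *)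
exists (fun p => if prime p then ln (N2 m p)%:R / Num.sqrt p%:R - 2 * sigma R m else 0).
split; last first.
  move=> p p_pr; rewrite p_pr double_sigma // subrKC.
  by rewrite divfK ?lnK ?posrE ?ltr0n ?N2_gt0 // gt_eqF // sqrtr_gt0 ltr0n prime_gt0.
apply/cvgrPdist_le => d d0; near=> p; rewrite sub0r normrN.
case: ifP => [p_pr|_]; last by rewrite normr0 ltW.
have q0 : 0 < Num.sqrt (p%:R : R) by rewrite sqrtr_gt0 ltr0n prime_gt0.
rewrite ler_norml lerBrDr lerBlDr ler_pdivlMr // ler_pdivrMr //; apply/andP; split.
  rewrite addrC; move: p_pr; near: p; exact: ln_N2_ge.
rewrite addrC; move: p_pr; near: p; exact: ln_N2_le.
Unshelve. all: by end_near. Qed.
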